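(* Let $\alpha>0$, $\rho\in(0,1)$ and $\beta\in[0,+\infty]$, and let $\mathcal{Y}_\cdot$ be a solution of the generalized Ornstein–Uhlenbeck equation $$d\mathcal{Y}_t=\Delta_\beta\mathcal{Y}_t\,dt+\sqrt{2\chi(\rho)}\,\nabla_\beta\,d\mathcal{W}_t,\qquad \chi(\rho)=\rho(1-\rho).$$ Then, for any $H\in\mathcal{S}_\beta(\mathbb{R})$, the function $f:\mathbb{R}_+\times\mathbb{R}_+\to\mathbb{R}$ defined by $f(s,t)=\mathcal{Y}_t(T^\beta_sH)$ is continuous.
   Context: Fix $\alpha>0$ (it only matters when $\beta=1$); $\mathbb{R}_+=[0,+\infty)$. The space $\mathcal{S}(\mathbb{R}\backslash\{0\})$: functions $H:\mathbb{R}\to\mathbb{R}$ such that (i) $H\in C^\infty(\mathbb{R}\backslash\{0\})$; (ii) $H$ is continuous from the right at $0$; (iii) for all non-negative integers $k,\ell$, $\|H\|_{k,\ell}:=\sup_{u\neq 0}\left|(1+|u|^\ell)\frac{d^kH}{du^k}(u)\right|<\infty$. For such $H$ the side limits $\frac{d^kH}{du^k}(0^+)$ and $\frac{d^kH}{du^k}(0^-)$ exist for every integer $k\ge 0$. The space $\mathcal{S}_\beta(\mathbb{R})$: - for $\beta<1$, $\mathcal{S}_\beta(\mathbb{R})$ is the usual Schwartz space $\mathcal{S}(\mathbb{R})$; - for $\beta=1$, it is the set of $H\in\mathcal{S}(\mathbb{R}\backslash\{0\})$ such that for every integer $k\ge0$, $\frac{d^{2k+1}H}{du^{2k+1}}(0^+)=\frac{d^{2k+1}H}{du^{2k+1}}(0^-)=\alpha\left(\frac{d^{2k}H}{du^{2k}}(0^+)-\frac{d^{2k}H}{du^{2k}}(0^-)\right)$;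 - for $\beta>1$ (including $\beta=+\infty$), it is the set of $H\in\mathcal{S}(\mathbb{R}\backslash\{0\})$ such that for every integer $k\ge0$, $\frac{d^{2k+1}H}{du^{2k+1}}(0^+)=\frac{d^{2k+1}H}{du^{2k+1}}(0^-)=0$. $\mathcal{S}_\beta(\mathbb{R})$ carries the Fréchet topology generated by all the norms $\|\cdot\|_{k,\ell}$, and $\mathcal{S}'_\beta(\mathbb{R})$ is its topological dual (with the strong topology). For $H\in\mathcal{S}_\beta(\mathbb{R})$: $\nabla_\beta H(u)=\frac{dH}{du}(u)$ for $u\neq0$, $\nabla_\beta H(0)=\frac{dH}{du}(0^+)$; $\Delta_\beta H(u)=\frac{d^2H}{du^2}(u)$ for $u\ne0$, $\Delta_\beta H(0)=\frac{d^2H}{du^2}(0^+)$. Also $\|G\|_{2,\beta}^2=\int_{\mathbb{R}}G(u)^2du+\frac{1}{\alpha^2}\mathbf{1}_{\beta=1}(G(0))^2$. Solution of the equation: $\mathcal{W}_t$ is an $\mathcal{S}'_\beta(\mathbb{R})$-valued Brownian motion. A solution $\mathcal{Y}_\cdot$ is a stochastic process with trajectories in $\mathcal{C}([0,T],\mathcal{S}'_\beta(\mathbb{R}))$ for every $T>0$ such that, for every $H\in\mathcal{S}_\beta(\mathbb{R})$, $\mathcal{M}_t(H)=\mathcal{Y}_t(H)-\mathcal{Y}_0(H)-\int_0^t\mathcal{Y}_s(\Delta_\beta H)\,ds$ is a martingale with quadratic variation $2\chi(\rho)\,t\,\|\nabla_\beta H\|_{2,\beta}^2$. The continuity claimed is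 for trajectories of $\mathcal{Y}$. The semigroup $T^\beta_t:\mathcal{S}_\beta(\mathbb{R})\to\mathcal{S}_\beta(\mathbb{R})$: $T^\beta_0$ is the identity. For $t>0$, let $\phi_t(x)=\frac{1}{\sqrt{4\pi t}}e^{-x^2/(4t)}$, $g_{\mathrm{even}}(x)=\frac{g(x)+g(-x)}{2}$, $g_{\mathrm{odd}}(x)=\frac{g(x)-g(-x)}{2}$, and $\mathrm{sign}(x)=1$ for $x\ge0$, $\mathrm{sign}(x)=-1$ for $x<0$. For $x\in\mathbb{R}$: - for $\beta\in[0,1)$, $T^\beta_t g(x)=\int_{\mathbb{R}}\phi_t(x-y)g(y)\,dy$; - for $\beta\in(1,+\infty]$, $T^\beta_t g(x)=\int_0^{+\infty}\left[\phi_t(x-y)+\phi_t(x+y)\right]g(y\,\mathrm{sign}(x))\,dy$; - for $\beta=1$, $$T^\beta_t g(x)=\int_{\mathbb{R}}\phi_t(x-y)g_{\mathrm{even}}(y)\,dy+\mathrm{sign}(x)e^{2\alpha|x|}\int_{|x|}^{+\infty}e^{-2\alpha z}\int_0^{+\infty}\left[\tfrac{z-y+4\alpha t}{2t}\phi_t(z-y)+\tfrac{z+y-4\alpha t}{2t}\phi_t(z+y)\right]g_{\mathrm{odd}}(y)\,dy\,dz.$$ *)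

(* Defs.v *)
From HB Require Import structures.
From mathcomp Require Import all_boot all_order all_algebra.
From mathcomp Require Import ring.
From mathcomp Require Import all_classical all_reals all_analysis.

Set Implicit Arguments.
Unset Strict Implicit.
Unset Printing Implicit Defensive.

Import Order.TTheory GRing.Theory Num.Theory.
Import numFieldNormedType.Exports.

Local Open Scope classical_set_scope.
Local Open Scope ring_scope.

Section test_functions.
Context {R : realType}.
Implicit Types (D : set R) (F G H : R -> R) (k l : nat).

(* C^oo on D when D is open: derive1n is total, so differentiability of all the
   iterated derivatives has to be required explicitly. *)
Definition smooth_on D H := forall k (u : R), D u -> derivable (derive1n k H) u 1.

Definition seminorm_on D k l H : \bar R :=
  ereal_sup [set (`|(1 + `|u| ^+ l) * derive1n k H u|)%:E | u in D].

Definition schwartz_on D H :=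
  smooth_on D H /\ forall k l, (seminorm_on D k l H < +oo)%E.

Definition punctured : set R := [set u | u != 0].

(* One-sided limits at 0 of the k-th derivative off 0; they exist as soon as
   schwartz_on punctured H, see cvg_deriv_right and cvg_deriv_left. *)
Definition deriv_right k H : R := lim (derive1n k H u @[u --> 0^'+]).
Definition deriv_left k H : R := lim (derive1n k H u @[u --> 0^'-]).

Definition schwartz_punctured H :=
  schwartz_on punctured H /\ H u @[u --> 0^'+] --> H 0.

Definition Sbeta (alpha : R) (beta : \bar R) : set (R -> R) :=
  if (beta < 1)%E then schwartz_on setT
  else if beta == 1%E then
    [set H | schwartz_punctured H /\
      forall k, deriv_right k.*2.+1 H = deriv_left k.*2.+1 H /\
        deriv_left k.*2.+1 H
          = alpha * (deriv_right k.*2 H - deriv_left k.*2 H)]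
  else
    [set H | schwartz_punctured H /\
      forall k, deriv_right k.*2.+1 H = 0 /\ deriv_left k.*2.+1 H = 0].

Definition nabla H : R -> R :=
  fun u => if u == 0 then deriv_right 1 H else derive1n 1 H u.
Definition laplace H : R -> R :=
  fun u => if u == 0 then deriv_right 2 H else derive1n 2 H u.

Lemma eq_derive1n_open D F G : open D -> {in D, F =1 G} ->
  forall k, {in D, derive1n k F =1 derive1n k G}.
Proof.
move=> oD FG; elim=> [|k IH] u uD; first exact: FG.
rewrite !derive1nS !derive1E; apply: near_eq_derive.
have := open_nbhs_nbhs (conj oD (set_mem uD)).
by apply: filterS => v /mem_set vD; exact: IH.
Qed.

Lemma eq_smooth_open D F G : open D -> {in D, F =1 G} ->
  smooth_on D F -> smooth_on D G.
Proof.
move=> oD FG sF k u uD; apply: near_eq_derivable (sF k u uD).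
have := open_nbhs_nbhs (conj oD uD).
by apply: filterS => v /mem_set vD; exact: (eq_derive1n_open oD FG).
Qed.

Lemma derive1n_lin D a F G : open D -> smooth_on D F -> smooth_on D G ->
  forall k, {in D, derive1n k (a *: F + G) =1 a *: derive1n k F + derive1n k G}.
Proof.
move=> oD sF sG; elim=> [//|k IH] u uD.
have dF := sF k u (set_mem uD); have dG := sG k u (set_mem uD).
rewrite !derive1nS !derive1E.
rewrite (@near_eq_derive _ _ _ _ (a *: derive1n k F + derive1n k G)); last first.
  have := open_nbhs_nbhs (conj oD (set_mem uD)).
  by apply: filterS => v /mem_set vD; exact: IH.
rewrite deriveD ?deriveZ//; last exact: derivableZ.
by rewrite /= -!derive1E.
Qed.

Lemma smooth_lin D a F G : open D -> smooth_on D F -> smooth_on D G ->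
  smooth_on D (a *: F + G).
Proof.
move=> oD sF sG k u uD.
apply: (@near_eq_derivable _ _ _ (a *: derive1n k F + derive1n k G)).
- have := open_nbhs_nbhs (conj oD uD).
  by apply: filterS => v /mem_set vD; rewrite (derive1n_lin a oD sF sG).
- by apply: derivableD; [apply: derivableZ; exact: sF|exact: sG].
Qed.

Lemma seminorm_onP D k l H : (seminorm_on D k l H < +oo)%E <->
  exists M, forall u, D u -> `|(1 + `|u| ^+ l) * derive1n k H u| <= M.
Proof.
split=> [fin|[M bM]]; last first.
  apply: (@le_lt_trans _ _ M%:E); last exact: ltry.
  by apply: ge_ereal_sup => _ [u uD <-]; rewrite lee_fin bM.
have ub u : D u -> ((`|(1 + `|u| ^+ l) * derive1n k H u|)%:E <= seminorm_on D k l H)%E.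
  by move=> uD; apply: ereal_sup_ubound; exists u.
move: fin ub; case: (seminorm_on D k l H) => [M _ ub|//|_ ub].
  by exists M => u /ub; rewrite lee_fin.
by exists 0 => u /ub.
Qed.

Lemma schwartz_lin D a F G : open D -> schwartz_on D F -> schwartz_on D G ->
  schwartz_on D (a *: F + G).
Proof.
move=> oD [sF bF] [sG bG]; split; first exact: smooth_lin.
move=> k l; have /seminorm_onP [M HM] := bF k l.
have /seminorm_onP [N HN] := bG k l.
apply/seminorm_onP; exists (`|a| * M + N) => u uD.
rewrite (derive1n_lin a oD sF sG) ?inE//= mulrDr.
apply: (le_trans (ler_normD _ _)); apply: lerD; last exact: HN.
by rewrite /= mulrCA normrM ler_wpM2l//; exact: HM.
Qed.

Lemma open_punctured : open punctured.
Proof.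
rewrite (_ : punctured = ~` [set 0]); last first.
  by apply/seteqP; split=> x /= /eqP.
exact/closed_openC/closed_eq.
Qed.


Lemma cvg_lipschitz (F : set_system R) D M H : ProperFilter F ->
  F D -> F --> (0 : R) ->
  (forall x y, D x -> D y -> `|H x - H y| <= M * `|x - y|) ->
  cvg (H u @[u --> F]).
Proof.
move=> FF FD F0 HM; apply/cauchy_cvgP/cauchy_ballP => e e0; near_simpl.
pose d : R := e / (2 * (`|M| + 1)).
have M0 : 0 < `|M| + 1 by rewrite ltr_wpDl.
have d0 : 0 < d by rewrite divr_gt0// mulr_gt0.
have Fd : F (D `&` [set u | `|u| < d]).
  apply: filterI => //; apply: F0.
  by exact: (@cvgr0_norm_lt R R R (nbhs (0 : R)) _ id (@cvg_id _ _) d d0).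
exists (D `&` [set u | `|u| < d], D `&` [set u | `|u| < d]) => //.
move=> [x y] /= [[Dx xd] [Dy yd]].
rewrite /ball/=; apply: (le_lt_trans (HM x y Dx Dy)).
have xy : `|x - y| < d + d.
  by rewrite (le_lt_trans (ler_normB _ _))// ltrD.
apply: (@le_lt_trans _ _ ((`|M| + 1) * `|x - y|)).
  by rewrite ler_wpM2r// (le_trans (ler_norm _))// lerDl.
rewrite -ltr_pdivlMl// (lt_le_trans xy)// -mulr2n -mulr_natl /d invfM.
by rewrite (mulrCA e) mulVKf ?pnatr_eq0// mulrC.
Qed.

Lemma cvg_deriv (F : set_system R) D k H : ProperFilter F ->
  F D -> F --> (0 : R) -> is_interval D -> D `<=` punctured ->
  schwartz_on punctured H -> cvg (derive1n k H u @[u --> F]).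
Proof.
move=> FF FD F0 iD Dp [sH bH].
have /seminorm_onP [M HM] := bH k.+1 0%N.
have M0 u : D u -> `|derive1n k.+1 H u| <= M.
  move=> Du; apply: le_trans (HM _ (Dp _ Du)).
  by rewrite expr0 normrM ger0_norm// ler_peMl// lerDl.
apply: (@cvg_lipschitz _ D M) => // x y Dx Dy.
wlog xy : x y Dx Dy / x < y.
  move=> W; have [xy|yx|->] := ltgtP x y; first exact: W.
    by rewrite distrC (distrC x); exact: W.
  by rewrite !subrr normr0 mulr0.
have xyD z : x <= z <= y -> D z by exact: iD.
have dH z : x <= z <= y -> derivable (derive1n k H) z 1.
  by move=> /xyD /Dp; exact: sH.
have [||z] := @MVT _ (derive1n k H) (derive1n k.+1 H) x y xy.
- move=> z zxy; rewrite derive1nS derive1E; apply: derivableP.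
  by apply: dH; rewrite !ltW ?(itvP zxy).
- by apply: derivable_within_continuous => z; rewrite in_itv; exact: dH.
- move=> zxy E; rewrite distrC E normrM (distrC x) ler_wpM2r//.
  by apply: M0; apply: xyD; rewrite !ltW ?(itvP zxy).
Unshelve. all: by end_near. Qed.

Lemma cvg_deriv_right k H : schwartz_on punctured H ->
  derive1n k H u @[u --> 0^'+] --> deriv_right k H.
Proof.
apply: (@cvg_deriv _ [set u | 0 < u]).
- exact: nbhs_right_gt.
- exact: cvg_within.
- by move=> x y /= x0 y0 z /andP[xz _]; exact: lt_le_trans xz.
- by move=> x /= x0; rewrite /punctured/= gt_eqF.
Qed.

Lemma cvg_deriv_left k H : schwartz_on punctured H ->
  derive1n k H u @[u --> 0^'-] --> deriv_left k H.
Proof.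
apply: (@cvg_deriv _ [set u | u < 0]).
- exact: nbhs_left_lt.
- exact: cvg_within.
- by move=> x y /= x0 y0 z /andP[_ zy]; exact: le_lt_trans y0.
- by move=> x /= x0; rewrite /punctured/= lt_eqF.
Qed.

Lemma right_punctured : \forall u \near (0 : R)^'+, u \in punctured.
Proof.
apply: filterS (nbhs_right_gt _) => u u0.
by rewrite inE /punctured/= gt_eqF.
Qed.

Lemma left_punctured : \forall u \near (0 : R)^'-, u \in punctured.
Proof.
apply: filterS (nbhs_left_lt _) => u u0.
by rewrite inE /punctured/= lt_eqF.
Qed.

Lemma deriv_right_lin k a F G :
  schwartz_on punctured F -> schwartz_on punctured G ->
  deriv_right k (a *: F + G) = a * deriv_right k F + deriv_right k G.
Proof.
move=> sF sG; apply: cvg_lim => //.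
have : a * derive1n k F u + derive1n k G u @[u --> 0^'+] -->
    a * deriv_right k F + deriv_right k G.
  by apply: cvgD; [apply: cvgMr|]; exact: cvg_deriv_right.
apply: cvg_trans; apply: near_eq_cvg.
apply: filterS right_punctured => u up.
by rewrite (derive1n_lin a open_punctured sF.1 sG.1).
Qed.

Lemma deriv_left_lin k a F G :
  schwartz_on punctured F -> schwartz_on punctured G ->
  deriv_left k (a *: F + G) = a * deriv_left k F + deriv_left k G.
Proof.
move=> sF sG; apply: cvg_lim => //.
have : a * derive1n k F u + derive1n k G u @[u --> 0^'-] -->
    a * deriv_left k F + deriv_left k G.
  by apply: cvgD; [apply: cvgMr|]; exact: cvg_deriv_left.
apply: cvg_trans; apply: near_eq_cvg.
apply: filterS left_punctured => u up.
by rewrite (derive1n_lin a open_punctured sF.1 sG.1).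
Qed.

Lemma schwartz_punctured_lin a F G : schwartz_punctured F ->
  schwartz_punctured G -> schwartz_punctured (a *: F + G).
Proof.
move=> [sF cF] [sG cG]; split; first exact: (schwartz_lin a open_punctured).
by apply: cvgD => //; exact: cvgMr.
Qed.

Lemma derive1n_laplace H k :
  {in punctured, derive1n k (laplace H) =1 derive1n k.+2 H}.
Proof.
move=> u up; rewrite -addn2 /derive1n iterD.
apply: (eq_derive1n_open open_punctured) => // v.
by rewrite inE /punctured/= /laplace => /negbTE ->.
Qed.

Lemma deriv_right_laplace H k :
  deriv_right k (laplace H) = deriv_right k.+2 H.
Proof.
rewrite /deriv_right; congr (lim _); rewrite eqEsubset.
split; apply/near_eq_cvg; apply: filterS right_punctured => u up;
by rewrite derive1n_laplace.
Qed.

Lemma schwartz_on_laplace H :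
  schwartz_on punctured H -> schwartz_on punctured (laplace H).
Proof.
move=> [sH bH]; split=> [k u up|k l].
  apply: near_eq_derivable (sH k.+2 u up).
  have := open_nbhs_nbhs (conj open_punctured up).
  by apply: filterS => v /mem_set vp; rewrite derive1n_laplace.
have /seminorm_onP [M HM] := bH k.+2 l.
apply/seminorm_onP; exists M => u up.
by rewrite derive1n_laplace ?inE//; exact: HM.
Qed.

Lemma deriv_left_laplace H k :
  deriv_left k (laplace H) = deriv_left k.+2 H.
Proof.
rewrite /deriv_left; congr (lim _); rewrite eqEsubset.
split; apply/near_eq_cvg; apply: filterS left_punctured => u up;
by rewrite derive1n_laplace.
Qed.

Lemma schwartz_punctured_laplace H :
  schwartz_on punctured H -> schwartz_punctured (laplace H).
Proof.
move=> sH; split; first exact: schwartz_on_laplace.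
have := @cvg_deriv_right 2 H sH; rewrite {2}/laplace eqxx.
apply: cvg_trans; apply: near_eq_cvg; apply: filterS right_punctured => u up.
by rewrite -(derive1n_laplace H 0 up).
Qed.

Lemma schwartz_setT_punctured H :
  schwartz_on setT H -> schwartz_punctured H.
Proof.
move=> [sH bH]; split; first split.
- by move=> k u _; exact: sH.
- move=> k l; have /seminorm_onP [M HM] := bH k l.
  by apply/seminorm_onP; exists M => u _; exact: HM.
- apply: cvg_at_right_filter; apply: differentiable_continuous.
  by apply/derivable1_diffP; exact: (sH 0%N).
Qed.

Lemma schwartz_setT_laplace H :
  schwartz_on setT H -> schwartz_on setT (laplace H).
Proof.
move=> HT; have [sH bH] := HT.
have -> : laplace H = derive1n 2 H.
  apply/funext => u; rewrite /laplace; case: eqP => // ->.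
  apply: cvg_lim => //; apply: cvg_at_right_filter.
  by apply: differentiable_continuous; apply/derivable1_diffP; exact: (sH 2%N).
have E k : derive1n k (derive1n 2 H) = derive1n k.+2 H.
  by rewrite -(addn2 k) /derive1n iterD.
split=> [k u _|k l]; first by rewrite E; exact: sH.
have /seminorm_onP [M HM] := bH k.+2 l.
by apply/seminorm_onP; exists M => u _; rewrite E; exact: HM.
Qed.

Lemma Sbeta_punctured alpha beta :
  Sbeta alpha beta `<=` [set H | schwartz_punctured H].
Proof.
rewrite /Sbeta => H; case: ifP => _; first exact: schwartz_setT_punctured.
by case: ifP => _ [].
Qed.

Lemma Sbeta_laplace alpha beta H :
  Sbeta alpha beta H -> Sbeta alpha beta (laplace H).
Proof.
rewrite /Sbeta; case: ifP => _; first exact: schwartz_setT_laplace.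
case: ifP => _ [[sH _] bH]; split; try exact: schwartz_punctured_laplace.
  by move=> k; rewrite !deriv_right_laplace !deriv_left_laplace; exact: (bH k.+1).
by move=> k; rewrite !deriv_right_laplace !deriv_left_laplace; exact: (bH k.+1).
Qed.

Definition Sbeta_pred alpha beta : {pred R -> R} := mem (Sbeta alpha beta).

Lemma Sbeta_submod alpha beta : submod_closed (Sbeta_pred alpha beta).
Proof.
have S0 D : schwartz_on D (0 : R -> R).
  have E k : derive1n k (0 : R -> R) = 0.
    elim: k => // k IH; rewrite derive1nS IH.
    by apply/funext => u; rewrite derive1_cst.
  split=> [k u _|k l]; first by rewrite E; exact: derivable_cst.
  apply/seminorm_onP; exists 0 => u _; rewrite E.
  by rewrite (_ : (0 : R -> R) u = 0)// mulr0 normr0.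
have P0 : schwartz_punctured 0 by split=> //; exact: cvg_cst.
have R0 k : deriv_right k (0 : R -> R) = 0.
  have := deriv_right_lin k (-1) P0.1 P0.1.
  by rewrite scaler0 addr0 mulN1r addNr.
have L0 k : deriv_left k (0 : R -> R) = 0.
  have := deriv_left_lin k (-1) P0.1 P0.1.
  by rewrite scaler0 addr0 mulN1r addNr.
have memS H : Sbeta_pred alpha beta H = (H \in Sbeta alpha beta) by [].
split=> [|a F G]; rewrite -!topredE/= !memS !inE /Sbeta; case: ifP => _.
- exact: S0.
- by case: ifP => _; split=> // k; rewrite !R0 !L0 ?subrr ?mulr0.
- by move=> sF sG; exact: (schwartz_lin a openT).
- case: ifP => _ [pF bF] [pG bG]; (split; first exact: schwartz_punctured_lin);
  have [sF _] := pF; have [sG _] := pG => k;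
  have [F1 F2] := bF k; have [G1 G2] := bG k;
  rewrite !(deriv_right_lin _ a sF sG) !(deriv_left_lin _ a sF sG).
    split; first by rewrite F1 G1.
    by rewrite F2 G2; ring.
  by rewrite F1 G1 F2 G2 mulr0 addr0.
Qed.

End test_functions.

Definition testfun (R : realType) (alpha : R) (beta : \bar R) : Type :=
  {H : R -> R | H \in Sbeta_pred alpha beta}.

Section testfun_lmod.
Context {R : realType} (alpha : R) (beta : \bar R).

HB.instance Definition _ := GRing.isSubmodClosed.Build R (R -> R)
  (Sbeta_pred alpha beta) (Sbeta_submod alpha beta).
HB.instance Definition _ := SubChoice.on (testfun alpha beta).
HB.instance Definition _ :=
  [SubChoice_isSubLmodule of testfun alpha beta by <:].
End testfun_lmod.

Section testfun_topology.
Context {R : realType} {alpha : R} {beta : \bar R}.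
Local Notation S := (testfun alpha beta).
Implicit Types (F G H : S) (k l N : nat).

(* The norm || . ||_{k,l}. For beta < 1 too the supremum is taken over u != 0,
   which by continuity is the supremum over R. *)
Definition tnorm k l H : R := fine (seminorm_on punctured k l (val H)).

Lemma testfunP H : Sbeta alpha beta (val H).
Proof. by apply/set_mem; exact: (valP H). Qed.

Lemma testfun_schwartz H : schwartz_on punctured (val H).
Proof. by have [] := Sbeta_punctured (testfunP H). Qed.

Lemma tnormE k l H : seminorm_on punctured k l (val H) = (tnorm k l H)%:E.
Proof.
rewrite /tnorm fineK// fin_numElt (testfun_schwartz H).2 andbT.
apply: (@lt_le_trans _ _ 0%E); first exact: ltNyr.
apply: le_trans (ereal_sup_ubound _); last first.
  by exists 1 => //; rewrite /punctured/= oner_neq0.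
by rewrite lee_fin.
Qed.

Lemma tnorm_ub k l H u : u != 0 ->
  `|(1 + `|u| ^+ l) * derive1n k (val H) u| <= tnorm k l H.
Proof.
by move=> u0; rewrite -lee_fin -tnormE; apply: ereal_sup_ubound; exists u.
Qed.

Lemma tnorm_le k l H M :
  (forall u, u != 0 -> `|(1 + `|u| ^+ l) * derive1n k (val H) u| <= M) ->
  tnorm k l H <= M.
Proof.
move=> HM; rewrite -lee_fin -tnormE.
by apply: ge_ereal_sup => _ [u u0 <-]; rewrite lee_fin HM.
Qed.

Lemma tnorm_ge0 k l H : 0 <= tnorm k l H.
Proof. by apply: le_trans (tnorm_ub k l H (oner_neq0 R)). Qed.

Lemma tnorm_lin k l a F G :
  tnorm k l (a *: F + G) <= `|a| * tnorm k l F + tnorm k l G.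
Proof.
apply: tnorm_le => u u0.
have [sF _] := testfun_schwartz F; have [sG _] := testfun_schwartz G.
rewrite (_ : val _ = a *: val F + val G)//.
rewrite (derive1n_lin a open_punctured sF sG) ?inE//= mulrDr.
apply: (le_trans (ler_normD _ _)); apply: lerD; last exact: tnorm_ub.
by rewrite /= mulrCA normrM ler_wpM2l//; exact: tnorm_ub.
Qed.

Lemma tnorm0 k l : tnorm k l 0 = 0.
Proof.
apply/eqP; rewrite eq_le tnorm_ge0 andbT.
apply: tnorm_le => u u0.
have := derive1n_lin (-1) open_punctured (testfun_schwartz 0).1
   (testfun_schwartz 0).1 k (mem_set u0).
rewrite (_ : -1 *: val (0 : S) + val (0 : S) = val (0 : S)); last first.
  by rewrite scaler0 addr0.
by rewrite scaleN1r addNr => ->; rewrite mulr0 normr0.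
Qed.

Lemma tnormZ k l a F : tnorm k l (a *: F) <= `|a| * tnorm k l F.
Proof. by have := tnorm_lin k l a F 0; rewrite tnorm0 !addr0. Qed.

Lemma tnormD k l F G : tnorm k l (F + G) <= tnorm k l F + tnorm k l G.
Proof. by have := tnorm_lin k l 1 F G; rewrite scale1r normr1 mul1r. Qed.

Lemma tnormN k l F : tnorm k l (- F) = tnorm k l F.
Proof.
have W G : tnorm k l (- G) <= tnorm k l G.
  by rewrite -scaleN1r (le_trans (tnormZ _ _ _ _))// normrN1 mul1r.
by apply/eqP; rewrite eq_le W -{1}(opprK F) W.
Qed.

Definition tball N (e : R) F : set S :=
  [set G | forall k l, (k <= N)%N -> (l <= N)%N -> tnorm k l (F - G) < e].

(* The uniformity generated by all the norms tnorm k l. *)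
Definition testfun_ent : set_system (S * S) :=
  filter_from [set Ne : nat * R | 0 < Ne.2]
    (fun Ne => [set FG | tball Ne.1 Ne.2 FG.1 FG.2]).

Let ent_filter : Filter testfun_ent.
Proof.
apply: filter_from_filter; first by exists (0%N, 1) => /=.
move=> [N e] [M d] /= e0 d0; exists (maxn N M, Num.min e d) => /=.
  by rewrite lt_min e0.
move=> [F G] /= FG; split=> k l kN lN.
  have := FG k l; rewrite lt_min => /(_ _ _)/andP[] //.
  - by rewrite (leq_trans kN)// leq_maxl.
  - by rewrite (leq_trans lN)// leq_maxl.
have := FG k l; rewrite lt_min => /(_ _ _)/andP[] //.
- by rewrite (leq_trans kN)// leq_maxr.
- by rewrite (leq_trans lN)// leq_maxr.
Qed.

Let ent_refl A : testfun_ent A -> diagonal `<=` A.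
Proof.
move=> [[N e] /= e0 sA] [F G] /diagonalP ->; apply: sA => k l _ _ /=.
by rewrite subrr tnorm0.
Qed.

Let ent_inv A : testfun_ent A -> testfun_ent (A^-1)%relation.
Proof.
move=> [[N e] /= e0 sA]; exists (N, e) => // -[F G] /= FG.
by apply: sA => k l kN lN /=; rewrite -opprB tnormN; exact: FG.
Qed.

Let ent_split A : testfun_ent A ->
  exists2 B, testfun_ent B & (B \; B)%relation `<=` A.
Proof.
move=> [[N e] /= e0 sA]; exists [set FG | tball N (e / 2) FG.1 FG.2].
  by exists (N, e / 2) => //=; rewrite divr_gt0.
move=> [F G] [H /= FH HG]; apply: sA => k l kN lN /=.
rewrite -(subrKA H); apply: (le_lt_trans (tnormD _ _ _ _)).
by rewrite (splitr e) ltrD//; [exact: FH|exact: HG].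
Qed.

HB.instance Definition _ := isUniform.Build S
  ent_filter ent_refl ent_inv ent_split.

Lemma nbhs_testfunP F (A : set S) :
  nbhs F A <-> exists N e, 0 < e /\ tball N e F `<=` A.
Proof.
rewrite -nbhs_entourageE; split.
  move=> [E [[N e] /= e0 sE] EA]; exists N, e; split=> // G FG.
  by apply: EA; apply/xsectionP; exact: sE.
move=> [N [e [e0 FA]]]; exists [set FG | tball N e FG.1 FG.2].
  by exists (N, e).
by move=> G /xsectionP; exact: FA.
Qed.

Lemma nbhs_tball N e F : 0 < e -> nbhs F (tball N e F).
Proof. by move=> e0; apply/nbhs_testfunP; exists N, e; split. Qed.

Let testfun_add_continuous : continuous (fun FG : S * S => FG.1 + FG.2).
Proof.
move=> [F G] A /nbhs_testfunP [N [e [e0 sA]]].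
exists (tball N (e / 2) F, tball N (e / 2) G) => /=.
  by split; apply: nbhs_tball; rewrite divr_gt0.
move=> [F' G'] [/= FF GG]; apply: sA => k l kN lN.
rewrite opprD addrACA; apply: (le_lt_trans (tnormD _ _ _ _)).
by rewrite (splitr e) ltrD//; [exact: FF|exact: GG].
Qed.

HB.instance Definition _ :=
  PreTopologicalNmodule_isTopologicalNmodule.Build S testfun_add_continuous.

Let tball_max F N : exists2 M, 0 < M &
  forall k l, (k <= N)%N -> (l <= N)%N -> tnorm k l F < M.
Proof.
exists (1 + \sum_(k < N.+1) \sum_(l < N.+1) tnorm k l F).
  by rewrite ltr_wpDr// sumr_ge0// => i _; rewrite sumr_ge0// => j _; exact: tnorm_ge0.
move=> k l kN lN.
rewrite (bigD1 (Ordinal (kN : (k < N.+1)%N)))//=.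
rewrite (bigD1 (Ordinal (lN : (l < N.+1)%N)))//=.
rewrite addrA ltr_wpDr//.
  by rewrite sumr_ge0// => i _; rewrite sumr_ge0// => j _; exact: tnorm_ge0.
rewrite addrA ltr_wpDr//; last by rewrite ltrDr.
by rewrite sumr_ge0// => i _; exact: tnorm_ge0.
Qed.

Let testfun_scale_continuous : continuous (fun aF : R^o * S => aF.1 *: aF.2).
Proof.
move=> [a F] A /nbhs_testfunP [N [e [e0 sA]]].
have [M M0 FM] := tball_max F N.
have a0 : 0 < `|a| + 1 by rewrite ltr_wpDl.
pose d := Num.min 1 (e / 2 / M).
have d0 : 0 < d by rewrite lt_min ltr01 !divr_gt0.
exists (ball (a : R^o) d, tball N (e / 2 / (`|a| + 1)) F) => /=.
  by split; [exact: nbhsx_ballx|apply: nbhs_tball; rewrite !divr_gt0].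
move=> [b G] [/= ab FG]; apply: sA => k l kN lN /=.
have -> : a *: F - b *: G = b *: (F - G) + (a - b) *: F.
  by rewrite scalerBr scalerBl [RHS]addrC subrKA.
apply: (le_lt_trans (tnormD _ _ _ _)); rewrite (splitr e) ltr_leD//.
  apply: (le_lt_trans (tnormZ _ _ _ _)).
  have b1 : `|b| <= `|a| + 1.
    rewrite -(subrK a b) (le_trans (ler_normD _ _))// addrC lerD2l.
    by rewrite distrC ltW// (lt_le_trans ab)// ge_min lexx.
  apply: (@le_lt_trans _ _ ((`|a| + 1) * tnorm k l (F - G))).
    by rewrite ler_wpM2r// tnorm_ge0.
  by rewrite mulrC -ltr_pdivlMr//; exact: FG.
apply: (le_trans (tnormZ _ _ _ _)).
apply: (@le_trans _ _ (d * M)).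
  by apply: ler_pM => //; [exact: tnorm_ge0|exact: ltW|exact/ltW/FM].
by rewrite -ler_pdivlMr// ge_min lexx orbT.
Qed.

HB.instance Definition _ :=
  TopologicalNmodule_isTopologicalLmodule.Build R S testfun_scale_continuous.

Let open_tball N e F : open (tball N e F).
Proof.
rewrite openE => G FG; apply/nbhs_testfunP; exists N.
have [d d0 dG] : exists2 d, 0 < d & forall k l, (k <= N)%N -> (l <= N)%N ->
    tnorm k l (F - G) + d <= e.
  pose d (kl : 'I_N.+1 * 'I_N.+1) := e - tnorm kl.1 kl.2 (F - G).
  exists (\big[Num.min/1]_kl d kl).
    apply: (big_ind (fun x => 0 < x)) => // [x y x0 y0|[k l] _]; first by rewrite lt_min x0.
    by rewrite subr_gt0; apply: FG; rewrite -ltnS ltn_ord.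
  move=> k l kN lN; rewrite -lerBrDl.
  exact: (bigmin_le_cond _
    (j := (Ordinal (kN : (k < N.+1)%N), Ordinal (lN : (l < N.+1)%N)))).
exists d; split=> // H GH k l kN lN.
rewrite -(subrKA G); apply: (le_lt_trans (tnormD _ _ _ _)).
by apply: lt_le_trans (dG k l kN lN); rewrite ltrD2l; exact: GH.
Qed.

Let testfun_locally_convex :
  exists2 B : set_system S, (forall b, b \in B -> convex_set b) & basis B.
Proof.
exists [set B | exists N e F, B = tball N e F].
  move=> B /[!inE] /= -[N [e [F ->]]]; apply/convex_setW.
  move=> G H /[!inE] FG FH t t0 t1 /[!inE] k l kN lN.
  have t'0 : 0 < 1 - t%:num by rewrite subr_gt0.
  rewrite [F - _](_ : _ = t%:num *: (F - G) + (1 - t%:num) *: (F - H)).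
    apply: (le_lt_trans (tnorm_lin _ _ _ _ _)).
    apply: (@lt_le_trans _ _ (t%:num * e + (1 - t%:num) * e)); last first.
      by rewrite -mulrDl addrC subrK mul1r.
    rewrite ltrD//; first by rewrite gtr0_norm// ltr_pM2l//; exact: FG.
    apply: (le_lt_trans (tnormZ _ _ _ _)).
    by rewrite gtr0_norm// ltr_pM2l//; exact: FH.
  rewrite !scalerBr addrACA -opprD -scalerDl.
  by rewrite (addrC t%:num) subrK scale1r.
split; first by move=> B [N [e [F ->]]]; exact: open_tball.
move=> F A /nbhs_testfunP [N [e [e0 FA]]]; exists (tball N e F) => //.
by split; [exists N, e, F|move=> k l _ _; rewrite subrr tnorm0].
Qed.

HB.instance Definition _ := Uniform_isTvs.Build R S testfun_locally_convex.

End testfun_topology.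

Section laplacian.
Context {R : realType} {alpha : R} {beta : \bar R}.

Lemma laplace_subproof (H : testfun alpha beta) :
  laplace (val H) \in Sbeta_pred alpha beta.
Proof. exact/mem_set/Sbeta_laplace/testfunP. Qed.

Definition laplacian (H : testfun alpha beta) : testfun alpha beta :=
  Sub (laplace (val H)) (laplace_subproof H).

End laplacian.

Section strong_dual.
Context {R : realType} (E : tvsType R).

(* Boundedness in the sense of von Neumann: every neighbourhood of 0 absorbs
   B. *)
Definition tvs_bounded (B : set E) : Prop :=
  forall U : set E, nbhs 0 U ->
    exists2 r : R, 0 < r & forall a : R, r <= `|a| -> B `<=` *:%R a @` U.

Record strong_dual := StrongDual {
  dual_fun :> E -> R ;
  dual_linear : scalar dual_fun ;
  dual_continuous : continuous dual_fun }.

(* The strong topology: uniform convergence on the bounded sets. *)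
HB.instance Definition _ := gen_eqMixin strong_dual.
HB.instance Definition _ := gen_choiceMixin strong_dual.
HB.instance Definition _ := Uniform.copy strong_dual
  (initial_topology (dual_fun : strong_dual -> {family tvs_bounded, E -> R})).

End strong_dual.

Section heat_semigroup.
Context {R : realType}.
Implicit Types (t x y z : R) (g : R -> R).
Local Notation mu := (@lebesgue_measure R).

Definition phi t x : R :=
  (Num.sqrt (4 * pi * t))^-1 * expR (- x ^+ 2 / (4 * t)).

Definition even_part g x : R := (g x + g (- x)) / 2.
Definition odd_part g x : R := (g x - g (- x)) / 2.

(* not Num.sg, which vanishes at 0 *)
Definition sign x : R := if 0 <= x then 1 else -1.

Definition semigroup_lt1 t g x : R := \int[mu]_y (phi t (x - y) * g y).

Definition semigroup_gt1 t g x : R :=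
  \int[mu]_(y in `[0, +oo[) ((phi t (x - y) + phi t (x + y)) * g (y * sign x)).

Definition semigroup_eq1 (alpha : R) t g x : R :=
  \int[mu]_y (phi t (x - y) * even_part g y) +
  sign x * expR (2 * alpha * `|x|) *
  \int[mu]_(z in `[`|x|, +oo[)
    (expR (- (2 * alpha * z)) *
     \int[mu]_(y in `[0, +oo[)
       (((z - y + 4 * alpha * t) / (2 * t) * phi t (z - y) +
         (z + y - 4 * alpha * t) / (2 * t) * phi t (z + y)) *
        odd_part g y)).

Definition semigroup_fun (alpha : R) (beta : \bar R) t g : R -> R :=
  if t == 0 then g
  else if (beta < 1)%E then semigroup_lt1 t g
  else if beta == 1%E then semigroup_eq1 alpha t g
  else semigroup_gt1 t g.

(* The value H is a default for the case, which does not occur for t >= 0,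
   that semigroup_fun leaves Sbeta. *)
Definition semigroup (alpha : R) (beta : \bar R) t (H : testfun alpha beta) :
  testfun alpha beta := insubd H (semigroup_fun alpha beta t (val H)).

Definition sqnorm2 (alpha : R) (beta : \bar R) g : R :=
  \int[mu]_u (g u ^+ 2) + (if beta == 1%E then (alpha ^+ 2)^-1 * g 0 ^+ 2 else 0).

End heat_semigroup.

(* Processes are indexed by R, and only their values at times >= 0 matter. *)
Section martingales.
Context {R : realType} {d : measure_display} {Omega : measurableType d}.
Variable P : probability Omega R.
Implicit Types (G : set (set Omega)) (F : R -> set (set Omega)).
Implicit Types (X Z : Omega -> R) (M A : R -> Omega -> R).

Definition measurable_wrt G X : Prop :=
  forall B : set R, measurable B -> G (X @^-1` B).

(* Z is a version of the conditional expectation of X given G *)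
Definition is_condexp G X Z : Prop :=
  [/\ P.-integrable setT (EFin \o X), P.-integrable setT (EFin \o Z),
      measurable_wrt G Z &
      forall B, G B -> \int[P]_(w in B) Z w = \int[P]_(w in B) X w].

Definition is_filtration F : Prop :=
  (forall t : R, 0 <= t -> sigma_algebra setT (F t) /\ F t `<=` measurable) /\
  (forall s t : R, 0 <= s -> s <= t -> F s `<=` F t).

Definition martingale F M : Prop :=
  is_filtration F /\
  forall s t : R, 0 <= s -> s <= t -> is_condexp (F s) (M t) (M s).

(* A is the continuous increasing adapted process, null at 0, that makes
   M ^+ 2 - A a martingale. *)
Definition has_quadratic_variation F M A : Prop :=
  [/\ forall t : R, 0 <= t -> measurable_wrt (F t) (A t),
      forall w, A 0 w = 0,
      forall w (s t : R), 0 <= s -> s <= t -> A s w <= A t w,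
      forall w, {within `[0, +oo[, continuous (fun t => A t w)} &
      martingale F (fun t w => M t w ^+ 2 - A t w)].

End martingales.

Section ornstein_uhlenbeck.
Context {R : realType} {alpha : R} {beta : \bar R}.
Context {d : measure_display} {Omega : measurableType d}.
Variables (rho : R) (P : probability Omega R).
Variable Y : R -> Omega -> strong_dual (testfun alpha beta).

Definition natural_filtration (t : R) : set (set Omega) :=
  <<s [set A | exists (s : R) (H : testfun alpha beta) (B : set R),
        [/\ 0 <= s, s <= t, measurable B & A = (fun w => Y s w H) @^-1` B]] >>.

Definition chi : R := rho * (1 - rho).

Definition mart (H : testfun alpha beta) (t : R) (w : Omega) : R :=
  Y t w H - Y 0 w H
  - \int[lebesgue_measure]_(s in `[0, t]) Y s w (laplacian H).

(* The driving noise, an Sbeta'-valued Brownian motion, does not appear: being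
   a solution is the following martingale problem. *)
Record OU_solution : Prop := {
  OU_measurable : forall (t : R) H, 0 <= t ->
    measurable_fun [set: Omega] (fun w => Y t w H) ;
  OU_continuous : forall w (T : R), 0 < T ->
    {within `[0, T], continuous (fun t => Y t w)} ;
  OU_martingale : forall H, martingale P natural_filtration (mart H) ;
  OU_quadratic_variation : forall H,
    has_quadratic_variation P natural_filtration (mart H)
      (fun t _ => 2 * chi * t * sqnorm2 alpha beta (nabla (val H))) }.

End ornstein_uhlenbeck.

(* Main.v *)
Require Import Defs.
From mathcomp Require Import all_boot all_order all_algebra.
From mathcomp Require Import ring lra.
From mathcomp Require Import all_classical all_reals all_analysis.
From mathcomp Require Import measurable_realfun.
Set Implicit Arguments.
Unset Strict Implicit.
Unset Printing Implicit Defensive.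
Import Order.TTheory GRing.Theory Num.Theory.
Import numFieldNormedType.Exports.
Local Open Scope classical_set_scope.
Local Open Scope ring_scope.

(** The theorem rests on two facts. The map t |-> Y t is continuous into the strong
dual, hence t |-> Y t G is continuous uniformly for G in a bounded set. And
s |-> T_s H is continuous into the space of test functions, so that it
remains in a bounded set while s does. Then
  Y t (T_s H) - Y t0 (T_s0 H)
    = (Y t - Y t0) (T_s H) + Y t0 (T_s H - T_s0 H)
tends to 0 ([joint_continuity]). The work lies in the semigroup: it must be
shown to preserve the space of test functions and to be continuous in s, down
to s = 0, for every seminorm.

Both follow from one remark. For a kernel K >= 0 with finite moments, the
average x |-> \int K r * g (x - s * r) dr of the translates of a Schwartz
function g is a Schwartz function, its derivatives are the averages of those
of g, and by the mean value theorem it is locally Lipschitz in the real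
parameter s, in every seminorm ([schwartz_avg], [avg_lipschitz]). The heat
semigroup at time t is such an average, with K = phi 1 and s = sqrt t
([heat_avg]), so that the path t |-> T_t g is locally Lipschitz in sqrt t, the
initial time corresponding to the scale s = 0.

The other two semigroups are reduced to the heat semigroup on the whole line.
A function of a line cut at 0 is a pair of functions on half-lines, and the
boundary conditions say precisely that suitable extensions of these are smooth
([schwartz_patch0]). For beta > 1 all odd derivatives vanish at 0, so the even
extension of each half is a Schwartz function; the semigroup solves the heat
equation for both extensions and keeps the relevant half of each
([paths_gt1]). For beta = 1 the even part of H is handled in the same way, and
the odd part w satisfies the Robin condition w'(0+) = 2 alpha w(0+), together
with its analogues of higher order. It says that w' - 2 alpha w, restricted to
the right half-line, has a smooth odd extension v0. The heat flow V of v0 is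
odd, and the solution of u' - 2 alpha u = V that decays at +oo is
  u x = - \int_0^oo exp (- 2 alpha r) V (x + r) dr,
again an average of translates, now with an exponential kernel. Integrating by
parts identifies this with the explicit kernel of the semigroup
([heat_robin], [half_line_exp_integral]), and u' = 2 alpha u + V gives back
the boundary conditions of all orders ([Sbeta_robin], [paths_eq1]). *)

(** * Derivatives of all orders and Schwartz bounds *)

Section smooth.
Context {R : realType}.
Implicit Types (D : set R) (f g p m : R -> R) (k l : nat).

(** Iterated derivatives are recognized by exhibiting a candidate of each
order, which avoids computing [derive1n] by hand. *)
Lemma derive1n_tower D (G : nat -> R -> R) : open D ->
  (forall k x, D x -> is_derive x (1 : R) (G k) (G k.+1 x)) ->
  smooth_on D (G 0) /\ forall k, {in D, derive1n k (G 0) =1 G k}.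
Proof.
move=> oD dG.
have E k : {in D, derive1n k (G 0) =1 G k}.
  elim: k => [//|k IH] x xD; rewrite derive1nS derive1E.
  have := dG k x (set_mem xD) => /@derive_val <-; apply: near_eq_derive.
  have := open_nbhs_nbhs (conj oD (set_mem xD)).
  by apply: filterS => y /mem_set; exact: IH.
split=> // k x Dx; have [+ _] := dG k x Dx; apply: near_eq_derivable.
have := open_nbhs_nbhs (conj oD Dx).
by apply: filterS => y /mem_set yD; rewrite E.
Qed.

Lemma smooth_is_derive D f k x : smooth_on D f -> D x ->
  is_derive x (1 : R) (derive1n k f) (derive1n k.+1 f x).
Proof.
by move=> sf Dx; split; [exact: sf|rewrite derive1nS derive1E].
Qed.

Lemma schwartz_on_bound D f k l : schwartz_on D f ->
  exists2 M, 0 <= M & forall x, D x -> `|(1 + `|x| ^+ l) * derive1n k f x| <= M.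
Proof.
move=> [_ /(_ k l)/seminorm_onP[M fM]]; exists (Num.max 0 M).
  by rewrite le_max lexx.
by move=> x Dx; rewrite le_max fM ?orbT.
Qed.

Lemma schwartz_towerP D (G : nat -> R -> R) : open D ->
  (forall k x, D x -> is_derive x (1 : R) (G k) (G k.+1 x)) ->
  (forall k l, exists M, forall x, D x -> `|(1 + `|x| ^+ l) * G k x| <= M) ->
  schwartz_on D (G 0).
Proof.
move=> oD dG bG; have [sG EG] := derive1n_tower oD dG; split=> // k l.
have [M GM] := bG k l; apply/seminorm_onP; exists M => x Dx.
by rewrite EG ?inE//; exact: GM.
Qed.

Lemma schwartz_continuous f k : schwartz_on setT f -> continuous (derive1n k f).
Proof.
move=> [sf _] x; apply: differentiable_continuous.
by apply/derivable1_diffP; exact: sf.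
Qed.

Lemma weight_ge1 l (x : R) : 1 <= 1 + `|x| ^+ l.
Proof. by rewrite lerDl; exact: exprn_ge0. Qed.

Lemma weight_ge0 l (x : R) : 0 <= 1 + `|x| ^+ l.
Proof. exact: le_trans (weight_ge1 l x). Qed.

(** The weights of the seminorms are submultiplicative up to a constant; this
is what lets a translation be absorbed by a moment of the kernel. *)
Lemma weight_submul l (x y : R) :
  1 + `|x + y| ^+ l <= 2 ^+ l * ((1 + `|x| ^+ l) * (1 + `|y| ^+ l)).
Proof.
have [x0 y0] : 0 <= `|x| ^+ l /\ 0 <= `|y| ^+ l by split; exact: exprn_ge0.
have e1 : 1 <= 2 ^+ l :> R by rewrite exprn_ege1// ler1n.
have H : `|x + y| ^+ l <= 2 ^+ l * (`|x| ^+ l + `|y| ^+ l).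
  apply: (@le_trans _ _ ((2 * Num.max `|x| `|y|) ^+ l)).
    rewrite lerXn2r ?nnegrE ?mulr_ge0 ?le_max ?normr_ge0//.
    by rewrite (le_trans (ler_normD _ _))// mulr_natl mulr2n lerD// le_max lexx ?orbT.
  rewrite exprMn ler_wpM2l//.
  by case: (leP `|x| `|y|) => _; rewrite ?lerDl ?lerDr.
apply: (@le_trans _ _ (2 ^+ l * (1 + (`|x| ^+ l + `|y| ^+ l)))).
  by rewrite mulrDr mulr1 lerD.
rewrite ler_pM2l ?exprn_gt0//.
have := mulr_ge0 x0 y0; set a := _ ^+ l; set b := _ ^+ l; nra.
Qed.

Lemma is_deriveN_arg f (x d : R) : is_derive (- x) (1 : R) f d ->
  is_derive x (1 : R) (fun y => f (- y)) (- d).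
Proof.
move=> df.
have := @is_derive1_comp _ f (-%R) x _ _ df (is_deriveNid x 1).
by rewrite mulrN1.
Qed.

Definition mirror f : R -> R := fun x => f (- x).

(** Stated for a symmetric open set because it is needed both on the whole
line and off the origin. *)
Lemma derive1n_mirror_on D f k : open D -> (forall x, D x -> D (- x)) ->
  schwartz_on D f ->
  schwartz_on D (mirror f) /\
  {in D, derive1n k (mirror f) =1 fun x => (-1) ^+ k * derive1n k f (- x)}.
Proof.
move=> oD DN [sf bf].
pose G k x := (-1) ^+ k * derive1n k f (- x).
have E0 : mirror f = G 0 by apply/funext => x; rewrite /G mul1r.
have dG n x : D x -> is_derive x (1 : R) (G n) (G n.+1 x).
  move=> Dx; rewrite /G exprS mulN1r mulNr -mulrN.
  apply: is_deriveZ; apply: is_deriveN_arg; apply: (smooth_is_derive _ sf).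
  exact: DN.
have [sG EG] := derive1n_tower oD dG.
split; last by move=> x xD; rewrite E0 EG.
rewrite E0; apply: (schwartz_towerP oD) => // n l.
have [M _ fM] := schwartz_on_bound n l (conj sf bf).
exists M => x Dx; have := fM (- x) (DN x Dx).
by rewrite /G mulrCA normrMsign normrN.
Qed.

Lemma schwartz_mirror f : schwartz_on setT f -> schwartz_on setT (mirror f).
Proof. by move=> sf; have [] := derive1n_mirror_on 0 openT (fun _ _ => I) sf. Qed.

Lemma derive1n_mirror f k : schwartz_on setT f ->
  derive1n k (mirror f) = fun x => (-1) ^+ k * derive1n k f (- x).
Proof.
move=> sf; have [_ E] := derive1n_mirror_on k openT (fun _ _ => I) sf.
by apply/funext => x; rewrite E ?inE.
Qed.

Lemma punctured_opp (x : R) : punctured x -> punctured (- x).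
Proof. by rewrite /punctured/= oppr_eq0. Qed.

Lemma schwartz_mirror_punctured f :
  schwartz_on punctured f -> schwartz_on punctured (mirror f).
Proof.
by move=> sf; have [] := derive1n_mirror_on 0 open_punctured punctured_opp sf.
Qed.

Lemma deriv_right_mirror f k : schwartz_on punctured f ->
  deriv_right k (mirror f) = (-1) ^+ k * deriv_left k f.
Proof.
move=> sf; apply: cvg_lim => //.
have [_ E] := derive1n_mirror_on k open_punctured punctured_opp sf.
have : (-1) ^+ k * derive1n k f (- u) @[u --> 0^'+] --> (-1) ^+ k * deriv_left k f.
  apply: cvgMr; rewrite -[X in X^'+]oppr0.
  by apply/cvg_at_leftNP; rewrite ?oppr0; exact: cvg_deriv_left.
apply: cvg_trans; apply: near_eq_cvg.
by apply: filterS right_punctured => u up; rewrite E.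
Qed.

Lemma deriv_left_mirror f k : schwartz_on punctured f ->
  deriv_left k (mirror f) = (-1) ^+ k * deriv_right k f.
Proof.
move=> sf; have sm := schwartz_mirror_punctured sf.
have := deriv_right_mirror k sm.
rewrite (_ : mirror (mirror f) = f); last first.
  by apply/funext => x; rewrite /mirror opprK.
by move=> ->; rewrite mulrA -exprMn mulrNN mulr1 expr1n mul1r.
Qed.

End smooth.

(** * Functions cut at the origin *)

Section splice.
Context {R : realType}.
Implicit Types (f g p m : R -> R) (k l : nat).

(** By the mean value theorem every difference quotient at [a] is a value of
[f'] at a point closer to [a]. *)
Lemma is_derive_removable f (f' : R -> R) (a L : R) : {for a, continuous f} ->
  (forall x, x != a -> is_derive x (1 : R) f (f' x)) ->
  f' x @[x --> a^'] --> L -> is_derive a (1 : R) f L.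
Proof.
move=> fa df f'L.
have lim : h^-1 *: (f (h + a) - f a) @[h --> 0^'] --> L.
  apply/cvgrPdist_lt => e e0.
  have /cvgrPdist_lt/(_ e e0) := f'L.
  rewrite near_withinE => /nbhs_ballP[d /= d0 dL].
  exists d => //= h; rewrite /ball_ /= sub0r normrN => hd h0.
  have key c : `|c - a| < d -> c != a -> f (h + a) - f a = f' c * h ->
      `|L - h^-1 *: (f (h + a) - f a)| < e.
    move=> cd ca ->.
    rewrite [_ *: _](_ : _ = f' c); last by rewrite /GRing.scale/= mulrCA mulVf// mulr1.
    by apply: dL => //; rewrite /ball /= distrC.
  have cont x y : {within `[x, y], continuous f}.
    apply: continuous_subspaceT => z; have [->//|za] := eqVneq z a.
    have [+ _] := df z za; move/derivable1_diffP.
    exact: differentiable_continuous.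
  have [hp|hn|h0'] := ltgtP 0 h; last by rewrite h0' eqxx in h0.
  - have aha : a < h + a by rewrite ltrDr.
    have [x|c cah E] := @MVT _ f f' a (h + a) aha _ (@cont _ _).
      by rewrite in_itv/= => /andP[ax _]; apply: df; rewrite gt_eqF.
    apply: (key c); [|by rewrite gt_eqF ?(itvP cah)|by rewrite E addrK].
    rewrite gtr0_norm ?subr_gt0 ?(itvP cah)//.
    rewrite ltrBlDr (lt_trans _ (_ : h + a < d + a)) ?(itvP cah)//.
    by rewrite ltrD2r (le_lt_trans (ler_norm _)).
  - have aha : h + a < a by rewrite gtrDr.
    have [x|c cah E] := @MVT _ f f' (h + a) a aha _ (@cont _ _).
      by rewrite in_itv/= => /andP[_ xa]; apply: df; rewrite lt_eqF.
    apply: (key c); [|by rewrite lt_eqF ?(itvP cah)|]; last first.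
      by rewrite -opprB E opprD addrCA subrr addr0 mulrN opprK.
    rewrite distrC gtr0_norm ?subr_gt0 ?(itvP cah)//.
    rewrite ltrBlDr -ltrBlDl (lt_trans _ (_ : h + a < _)) ?(itvP cah)//.
    rewrite addrC ltrD2r ltrNl.
    by rewrite (le_lt_trans (ler_norm _))// normrN.
have ext : (fun h => h^-1 *: (f (h *: (1 : R) + a) - f a)) =
           (fun h => h^-1 *: (f (h + a) - f a)).
  by apply/funext => h; rewrite [h *: _](_ : _ = h)// /GRing.scale/= mulr1.
split; first by rewrite /derivable ext; apply/cvg_ex; exists L.
by rewrite /derive ext; exact: cvg_lim lim.
Qed.

Lemma cvg_two_sided (f : R -> R) (a L : R) :
  f x @[x --> a^'+] --> L -> f x @[x --> a^'-] --> L -> f x @[x --> a^'] --> L.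
Proof.
move=> fr fl; apply/cvgrPdist_lt => e e0.
have /cvgrPdist_lt/(_ e e0) := fr; have /cvgrPdist_lt/(_ e e0) := fl.
rewrite /at_left /at_right !near_withinE => Hl Hr.
suff : \forall x \near a, x != a -> `|L - f x| < e by [].
near=> x => xa; have [xa'|xa'|xa'] := ltgtP x a; last by rewrite xa' eqxx in xa.
- by have := near Hl x; apply.
- by have := near Hr x; apply.
Unshelve. all: by end_near. Qed.

Lemma near0_punctured (x : R) : x != 0 -> \forall y \near x, y \in punctured.
Proof.
move=> x0; have := open_nbhs_nbhs (conj open_punctured (x0 : punctured x)).
by apply: filterS => y /mem_set.
Qed.

(** A singularity at 0 is removable as soon as the one-sided limits of all
derivatives agree: [is_derive_removable] applies to one order after the other.
*)
Lemma schwartz_removable f : schwartz_punctured f ->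
  (forall k, deriv_right k f = deriv_left k f) -> schwartz_on setT f.
Proof.
move=> [sf f0] EL.
pose G k (x : R) := if x == 0 then deriv_right k f else derive1n k f x.
have E0 : f = G 0%N.
  apply/funext => x; rewrite /G; case: eqP => // ->.
  by apply/esym/cvg_lim.
have dG' k x : x != 0 -> is_derive x (1 : R) (G k) (G k.+1 x).
  move=> x0; rewrite {2}/G (negbTE x0).
  have := smooth_is_derive k sf.1 (x0 : punctured x).
  have near_fG : \near x, derive1n k f x = G k x.
    apply: filterS (near0_punctured x0) => y; rewrite inE /punctured/= => y0.
    by rewrite /G (negbTE y0).
  move=> [d1 d2]; split; first exact: near_eq_derivable near_fG d1.
  by rewrite -d2; apply: near_eq_derive; apply: filterS near_fG => y ->.
have GL k : G k x @[x --> 0^'] --> G k 0.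
  rewrite {2}/G eqxx; apply: cvg_two_sided.
    have := @cvg_deriv_right _ k _ sf; apply: cvg_trans; apply: near_eq_cvg.
    apply: filterS right_punctured => u; rewrite inE /punctured/= => u0.
    by rewrite /G (negbTE u0).
  have := @cvg_deriv_left _ k _ sf; rewrite EL; apply: cvg_trans; apply: near_eq_cvg.
  apply: filterS left_punctured => u; rewrite inE /punctured/= => u0.
  by rewrite /G (negbTE u0).
have dG k x : setT x -> is_derive x (1 : R) (G k) (G k.+1 x).
  move=> _; have [->|] := eqVneq x 0; last exact: dG'.
  refine (is_derive_removable _ (dG' k) (GL k.+1)).
  by apply/continuous_withinNx; exact: GL.
rewrite E0; apply: (schwartz_towerP openT dG) => k l.
have [M _ fM] := schwartz_on_bound k l sf.
exists (Num.max M `|(1 + `|0 : R| ^+ l) * deriv_right k f|) => x _; rewrite /G.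
by case: eqP => [->|/eqP x0]; rewrite le_max ?lexx ?orbT// fM.
Qed.

Definition splice p m : R -> R := fun x => if 0 <= x then p x else m x.

Lemma splice_same p : splice p p = p.
Proof. by apply/funext => x; rewrite /splice; case: ifP. Qed.

Lemma splice_ge0 p m x : 0 <= x -> splice p m x = p x.
Proof. by rewrite /splice => ->. Qed.

Lemma splice_lt0 p m x : x < 0 -> splice p m x = m x.
Proof. by rewrite /splice ltNge => /negbTE ->. Qed.

(** Off the origin, [splice p m] coincides near each point with one of the two
functions, so that all its derivatives are spliced derivatives. *)
Lemma splice_tower p m : schwartz_on punctured p -> schwartz_on punctured m ->
  forall k x, punctured x ->
  is_derive x (1 : R) (splice (derive1n k p) (derive1n k m))
                (splice (derive1n k.+1 p) (derive1n k.+1 m) x).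
Proof.
move=> [sp _] [sm _] k x Px; have [d1 d2] := smooth_is_derive k sp Px.
have [e1 e2] := smooth_is_derive k sm Px; move: Px; rewrite /punctured/= => x0.
have [xp|xn|x0'] := ltgtP 0 x; last by rewrite x0' eqxx in x0.
- have N : \near x, derive1n k p x = splice (derive1n k p) (derive1n k m) x.
    by apply: filterS (lt_nbhsr xp) => y y0; rewrite /splice ltW.
  split; first exact: near_eq_derivable N d1.
  have -> : splice (derive1n k.+1 p) (derive1n k.+1 m) x = derive1n k.+1 p x.
    by apply: splice_ge0; exact: ltW.
  rewrite -d2.
  by apply: near_eq_derive; apply: filterS N => y ->.
- have N : \near x, derive1n k m x = splice (derive1n k p) (derive1n k m) x.
    by apply: filterS (lt_nbhsl xn) => y y0; rewrite /splice leNgt y0.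
  split; first exact: near_eq_derivable N e1.
  have -> : splice (derive1n k.+1 p) (derive1n k.+1 m) x = derive1n k.+1 m x.
    exact: splice_lt0.
  rewrite -e2.
  by apply: near_eq_derive; apply: filterS N => y ->.
Qed.

Lemma derive1n_splice p m k : schwartz_on punctured p -> schwartz_on punctured m ->
  {in punctured, derive1n k (splice p m) =1 splice (derive1n k p) (derive1n k m)}.
Proof.
by move=> sp sm; have [_] := derive1n_tower open_punctured (splice_tower sp sm).
Qed.

Lemma deriv_right_splice p m k : schwartz_on punctured p -> schwartz_on punctured m ->
  deriv_right k (splice p m) = deriv_right k p.
Proof.
move=> sp sm; apply: cvg_lim => //; have := @cvg_deriv_right _ k _ sp.
apply: cvg_trans; apply: near_eq_cvg; apply: filterS (nbhs_right_gt 0) => u u0.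
by rewrite derive1n_splice ?inE /punctured /= ?gt_eqF// /splice ltW.
Qed.

Lemma deriv_left_splice p m k : schwartz_on punctured p -> schwartz_on punctured m ->
  deriv_left k (splice p m) = deriv_left k m.
Proof.
move=> sp sm; apply: cvg_lim => //; have := @cvg_deriv_left _ k _ sm.
apply: cvg_trans; apply: near_eq_cvg; apply: filterS (nbhs_left_lt 0) => u u0.
by rewrite derive1n_splice ?inE /punctured /= ?lt_eqF// /splice leNgt u0.
Qed.

Lemma schwartz_on_splice p m : schwartz_on punctured p -> schwartz_on punctured m ->
  schwartz_on punctured (splice p m).
Proof.
move=> sp sm; apply: (schwartz_towerP open_punctured (splice_tower sp sm)) => k l.
have [M _ pM] := schwartz_on_bound k l sp.
have [N _ mN] := schwartz_on_bound k l sm.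
exists (Num.max M N) => x Px; rewrite /splice.
by case: ifP => _; rewrite le_max ?pM ?mN ?orbT.
Qed.

Lemma deriv_right_smooth p k : schwartz_on setT p -> deriv_right k p = derive1n k p 0.
Proof.
move=> sp; apply: cvg_lim => //.
by apply: cvg_at_right_filter; exact: schwartz_continuous.
Qed.

Lemma deriv_left_smooth p k : schwartz_on setT p -> deriv_left k p = derive1n k p 0.
Proof.
move=> sp; apply: cvg_lim => //.
by apply: cvg_at_left_filter; exact: schwartz_continuous.
Qed.

Lemma schwartz_setT_on p : schwartz_on setT p -> schwartz_on punctured p.
Proof. by move=> /schwartz_setT_punctured[]. Qed.

Lemma schwartz_splice p m : schwartz_on setT p -> schwartz_on setT m ->
  schwartz_punctured (splice p m).
Proof.
move=> sp sm; split; first by apply: schwartz_on_splice; exact: schwartz_setT_on.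
have : p u @[u --> 0^'+] --> p 0.
  by apply: cvg_at_right_filter; exact: (@schwartz_continuous _ p 0 sp).
rewrite {2}/splice lexx; apply: cvg_trans; apply: near_eq_cvg.
by apply: filterS (nbhs_right_gt 0) => u u0; rewrite /splice ltW.
Qed.

(** The value at 0 of a function given on the two half-lines carries no
information; it is replaced by the one that makes the function
right-continuous. *)
Definition patch0 f : R -> R := fun x => if x == 0 then deriv_right 0 f else f x.

Lemma patch0E f : {in punctured, f =1 patch0 f}.
Proof. by move=> x; rewrite inE /punctured/= /patch0 => /negbTE ->. Qed.

Lemma schwartz_patch0 f : schwartz_on punctured f ->
  (forall k, deriv_right k f = deriv_left k f) -> schwartz_on setT (patch0 f).
Proof.
move=> sf E; have Ek := eq_derive1n_open open_punctured (patch0E f).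
have R0 k : deriv_right k (patch0 f) = deriv_right k f.
  apply: cvg_lim => //; have := @cvg_deriv_right _ k _ sf.
  apply: cvg_trans; apply: near_eq_cvg.
  by apply: filterS right_punctured => u up; rewrite -Ek.
have L0 k : deriv_left k (patch0 f) = deriv_left k f.
  apply: cvg_lim => //; have := @cvg_deriv_left _ k _ sf.
  apply: cvg_trans; apply: near_eq_cvg.
  by apply: filterS left_punctured => u up; rewrite -Ek.
have sp : schwartz_on punctured (patch0 f).
  split; first exact: eq_smooth_open open_punctured (patch0E f) sf.1.
  move=> k l; have [M _ fM] := schwartz_on_bound k l sf.
  by apply/seminorm_onP; exists M => x Px; rewrite -Ek ?inE//; exact: fM.
apply: schwartz_removable => [|k]; last by rewrite R0 L0.
split=> //; have := @cvg_deriv_right _ 0 _ sp.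
by rewrite R0 (_ : deriv_right 0 f = patch0 f 0)// /patch0 eqxx.
Qed.

(** Right-continuity at 0 determines the missing value. *)
Lemma eq_schwartz_punctured f g : schwartz_punctured f -> schwartz_punctured g ->
  {in punctured, f =1 g} -> f = g.
Proof.
move=> [_ f0] [_ g0] E; apply/funext => x.
have [->|x0] := eqVneq x 0; last by rewrite E// inE.
apply: (cvg_unique _ f0) => //; move: g0; apply: cvg_trans; apply: near_eq_cvg.
by apply: filterS right_punctured => u up; rewrite E.
Qed.

End splice.

(** * Affine changes of variables for the Lebesgue integral *)

Section integrals.
Context {R : realType}.
Local Notation mu := (@lebesgue_measure R).
Implicit Types (f g : R -> R).
Local Open Scope ereal_scope.

(** Lebesgue measure is determined by its values on half-open intervals, whose
preimages under an affine map are intervals, with the orientation reversed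
when [a] is negative. *)
Lemma lebesgue_measure_affine (a b : R) (A : set R) : (a != 0)%R ->
  measurable A ->
  pushforward mu (fun r : measurableTypeR R => (a * r + b)%R : measurableTypeR R) A =
  (`|a|^-1)%:E * mu A.
Proof.
move=> a0 mA; set phi := (fun r : measurableTypeR R => (a * r + b)%R : measurableTypeR R).
have mphi : measurable_fun setT phi.
  by apply: measurable_funD => //; exact: measurable_funM.
have na0 : (0 < `|a|)%R by rewrite normr_gt0.
pose nu' m : {measure set (measurableTypeR R) -> \bar R} :=
   mscale (NngNum (normr_ge0 a)) 
     (@measure_function_pushforward__canonical__measure_function_Measure
        _ _ _ _ _ mu phi m).
pose nu := nu' mphi.
have E B : measurable B -> nu B = mu B.
  move=> mB; apply/esym/lebesgue_measure_unique => //= _ [[c d]] _ <-.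
  rewrite /nu /mscale/= /pushforward.
  have [ap|an|a00] := ltgtP 0%R a; last by rewrite -a00 eqxx in a0.
    rewrite (_ : _ @^-1` _ = `]((c - b) / a)%R, ((d - b) / a)%R]%classic); last first.
      apply/seteqP; split=> r; rewrite /= !in_itv/= ltr_pdivrMr// ler_pdivlMr//;
      by rewrite ltrBlDr lerBrDr (mulrC r).
    rewrite !lebesgue_measure_itv/= !lte_fin ltr_pM2r ?invr_gt0// ltrBlDr subrK.
    case: ifP => _; last by rewrite mule0.
    by rewrite -!EFinB -EFinM gtr0_norm// -mulrBl opprB addrA subrK mulrC divfK// gt_eqF.
  rewrite (_ : _ @^-1` _ = `[((d - b) / a)%R, ((c - b) / a)%R[%classic); last first.
    apply/seteqP; split=> r; rewrite /= !in_itv/= ltr_ndivlMr// ler_ndivrMr//;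
    by rewrite ltrBlDr lerBrDr (mulrC r) => /andP[-> ->].
  rewrite !lebesgue_measure_itv/= !lte_fin ltr_nM2r ?invr_lt0// ltrBlDr subrK.
  case: ifP => _; last by rewrite mule0.
  rewrite -!EFinB -EFinM ltr0_norm// -mulrBl opprB addrA subrK.
  by rewrite mulNr mulrC divfK ?opprB// lt_eqF.
rewrite -(E _ mA) /nu/mscale/= muleA -EFinM mulVf ?mul1e// gt_eqF//.
Qed.

Lemma ge0_integral_affine (a b : R) (f : R -> \bar R) : (a != 0)%R ->
  measurable_fun setT f -> (forall r, 0 <= f r) ->
  \int[mu]_r f r = `|a|%:E * \int[mu]_r f (a * r + b)%R.
Proof.
move=> a0 mf f0.
have na0 : (0 < `|a|)%R by rewrite normr_gt0.
have ia0 : (0 < `|a|^-1)%R by rewrite invr_gt0.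
pose phi := (fun r : measurableTypeR R => (a * r + b)%R : measurableTypeR R).
have mphi : measurable_fun setT phi.
  by apply: measurable_funD => //; exact: measurable_funM.
have := @ge0_integral_pushforward _ _ (measurableTypeR R) (measurableTypeR R) R phi
  mphi mu setT f.
rewrite preimage_setT => /(_ measurableT) E.
rewrite [X in _ * X](_ : _ = \int[pushforward mu phi]_y f y); last by rewrite E.
rewrite (_ : \int[pushforward mu phi]_y f y = (`|a|^-1)%:E * \int[mu]_y f y).
  by rewrite muleA -EFinM divff ?mul1e// gt_eqF.
transitivity (\int[mscale (NngNum (ltW ia0)) mu]_y f y).
  by apply: eq_measure_integral => A mA _; exact: lebesgue_measure_affine.
exact: ge0_integral_mscale.
Qed.

Lemma integrable_affine (a b : R) f : (a != 0)%R ->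
  mu.-integrable setT (EFin \o f) ->
  mu.-integrable setT (EFin \o (fun r => f (a * r + b)%R)).
Proof.
move=> a0 /integrableP[mf If]; have mf' := mf.
move/measurable_EFinP : mf' => mf'.
have mphi : measurable_fun setT (fun r : R => a * r + b)%R.
  by apply: measurable_funD => //; exact: measurable_funM.
apply/integrableP; split.
  by apply/measurable_EFinP; exact: (measurableT_comp mf' mphi).
have na0 : (0 < `|a|^-1)%R by rewrite invr_gt0 normr_gt0.
have := @ge0_integral_affine a b (fun r => `|(f r)%:E|) a0.
rewrite (_ : \int[mu]_r _ = \int[mu]_x `|(EFin \o f) x|)// => /(_ _ _)/esym E.
rewrite -(@lte_pmul2l _ `|a|%:E) ?fin_numE ?lte_fin ?normr_gt0//.
rewrite E; last by [].
  by rewrite gt0_muley ?lte_fin ?normr_gt0.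
by apply: measurableT_comp.
Qed.

Lemma Rintegral_affine (a b : R) f : (a != 0)%R ->
  mu.-integrable setT (EFin \o f) ->
  (\int[mu]_r f r = `|a| * \int[mu]_r f (a * r + b))%R.
Proof.
move=> a0 If; have Ia := integrable_affine b a0 If.
have [/measurable_EFinP mf _] := integrableP _ _ _ If.
have E0 (g : R -> R) : measurable_fun setT g -> (forall r, 0 <= g r)%R ->
    (\int[mu]_r g r = `|a| * \int[mu]_r g (a * r + b))%R.
  move=> mg g0; rewrite /Rintegral (@ge0_integral_affine a b (EFin \o g))//=.
    case: (\int[mu]_x _) => [r| |] //=.
      by rewrite gt0_muley ?lte_fin ?normr_gt0//= mulr0.
    by rewrite gt0_muleNy ?lte_fin ?normr_gt0//= mulr0.
  by apply/measurable_EFinP.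
have D (g : R -> R) : mu.-integrable setT (EFin \o g) ->
    (\int[mu]_r g r = \int[mu]_r (g^\+ r) - \int[mu]_r (g^\- r))%R.
  move=> Ig; rewrite -RintegralB//.
  - by apply: eq_Rintegral => r _; rewrite -[RHS]/((g^\+ - g^\-)%R r) funrposBneg.
  - exact: integrable_funrpos.
  - exact: integrable_funrneg.
set fa := (fun r => f (a * r + b)%R).
rewrite (D f If) (D fa Ia) mulrBr; congr (_ - _)%R.
  by apply: (E0 (f^\+)%R) => //; exact: measurable_funrpos.
by apply: (E0 (f^\-)%R) => //; exact: measurable_funrneg.
Qed.

End integrals.

(** * Integrals of derivatives over a half-line *)

Section improper_ftc.
Context {R : realType}.
Local Notation mu := (@lebesgue_measure R).
Implicit Types (f F : R -> R).

(** The formula on compact intervals that exhaust the half-line passes to the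
limit because the truncations of [f] are dominated by its absolute value. *)
Lemma Rintegral_itvoy_FTC f F (a l : R) :
  (forall x, a < x -> is_derive x (1 : R) F (f x)) ->
  (forall x, a < x -> {for x, continuous f}) ->
  mu.-integrable `]a, +oo[ (EFin \o f) ->
  F x @[x --> a^'+] --> F a -> F x @[x --> +oo] --> l ->
  \int[mu]_(x in `]a, +oo[) f x = l - F a.
Proof.
move=> dF cf If Fa Fl.
(* [hi] starts at [a + 2] so that [lo n < hi n] holds for [n = 0] too *)
pose lo n : R := a + n.+1%:R^-1; pose hi n : R := a + n.+2%:R.
have lohi n : lo n < hi n.
  rewrite /lo /hi ltrD2l (@le_lt_trans _ _ 1) ?ltr1n//.
  by rewrite invf_le1 ?ler1n.
have alo n : a < lo n by rewrite /lo ltrDl.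
have cl (x : R) n : lo n <= x -> a < x by apply: lt_le_trans.
pose g n := f \_ `[lo n, hi n].
have Eg n : \int[mu]_(x in `]a, +oo[) g n x = F (hi n) - F (lo n).
  rewrite -Rintegral_mkcondr (_ : _ `&` _ = `[lo n, hi n]%classic); last first.
    apply/seteqP; split=> [x []//|x xn]; split=> //=.
    by move: xn; rewrite /= !in_itv/= andbT => /andP[/cl].
  rewrite /Rintegral (@continuous_FTC2 _ _ F)//.
  - apply: continuous_in_subspaceT => x; rewrite inE/= in_itv/= => /andP[/cl ax _].
    exact: cf.
  - split=> [x| |].
    + by rewrite in_itv/= => /andP[/ltW/cl ax _]; have [] := dF x ax.
    + apply: cvg_at_right_filter; apply: differentiable_continuous.
      by apply/derivable1_diffP; have [] := dF _ (alo n).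
    + apply: cvg_at_left_filter; apply: differentiable_continuous.
      by apply/derivable1_diffP; have [] := dF _ (lt_trans (alo n) (lohi n)).
  - move=> x; rewrite in_itv/= => /andP[/ltW/cl ax _].
    by rewrite derive1E; have [] := dF x ax.
have mD : measurable (`]a, +oo[%classic : set R) by [].
have [/measurable_EFinP mf _] := integrableP _ _ _ If.
have gf x : a < x -> g n x @[n --> \oo] --> f x.
  move=> ax; apply: cvg_near_cst; near=> n.
  rewrite /g patchE ifT// inE/= in_itv/=; apply/andP; split.
  - rewrite /lo -lerBrDl ltW//; near: n.
    have ax0 : 0 < x - a by rewrite subr_gt0.
    exact: (near_infty_natSinv_lt (PosNum ax0)).
  - rewrite /hi -lerBlDl (@le_trans _ _ n%:R)//.
      by near: n; exact: nbhs_infty_ger.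
    by rewrite ler_nat -addn2 leq_addr.
have mg n : measurable_fun `]a, +oo[ (EFin \o g n).
  apply/measurable_EFinP; apply/measurable_restrict => //.
  by apply: measurable_funS mf => //; exact: subIsetl.
have gE : forall x, `]a, +oo[%classic x -> (g n x)%:E @[n --> \oo] --> (EFin \o f) x.
  move=> x /=; rewrite in_itv/= andbT => ax /=; apply: cvg_EFin; first exact: nearW.
  exact: gf.
have gb : {ae mu, forall x n, `]a, +oo[%classic x ->
    (`|(g n x)%:E| <= (EFin \o (fun x => `|f x|%R)) x)%E}.
  apply: aeW => x n _; rewrite /= lee_fin /g patchE.
  by case: ifP => // _; rewrite normr0.
have [_ _] := @dominated_convergence _ _ _ mu _ mD
  (fun n x => (g n x)%:E) (EFin \o f) (EFin \o (fun x => `|f x|)) mg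
  (measurable_int _ If) (aeW mu gE) (integrable_norm If) gb.
have fin : (\int[mu]_(x in `]a, +oo[) (EFin \o f) x)%E \is a fin_num.
  exact: integrable_fin_num If.
rewrite -(fineK fin) => /fine_cvg lim.
have lim2 : F (hi n) - F (lo n) @[n --> \oo] --> l - F a.
  apply: cvgB.
  - apply: ((cvg_pinftyP F l).1 Fl); apply/cvgryPge => r.
    near do rewrite /hi -lerBlDl; near=> n.
    apply: (@le_trans _ _ n%:R); last by rewrite ler_nat -addn2 leq_addr.
    by near: n; exact: nbhs_infty_ger.
  - apply: ((cvg_at_rightP F a (F a)).1 Fa lo); split; first exact: alo.
    rewrite -[X in _ --> X]addr0; apply: cvgD; first exact: cvg_cst.
    exact: cvg_harmonic.
apply: (cvg_unique _ _ lim2) => //; move: lim; apply: cvg_trans.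
rewrite (_ : (fun n => F (hi n) - F (lo n)) =
   (fun n => \int[mu]_(x in `]a, +oo[) g n x)); first exact: cvg_id.
by apply/funext => n; rewrite Eg.
Unshelve. all: by end_near. Qed.
End improper_ftc.

(** * Averages of translates *)

Section averages.
Context {R : realType}.
Local Notation mu := (@lebesgue_measure R).
Implicit Types (f g h K : R -> R) (k l : nat) (s t x y r : R).

(** All moments are required because the seminorms involve all polynomial
weights. *)
Definition moment_kernel K : Prop :=
  [/\ measurable_fun setT K, forall r, 0 <= K r &
      forall l, mu.-integrable setT (EFin \o (fun r => K r * `|r| ^+ l))].

Definition moment K l : R := \int[mu]_r (K r * (1 + `|r| ^+ l)).

(** The scale [s] ranges over all reals: the heat flow uses [s = sqrt t], and
[s = -1] averages the translates to the right. *)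
Definition avg K s g x : R := \int[mu]_r (K r * g (x - s * r)).

Section kernel.
Variable K : R -> R.
Hypothesis mK : moment_kernel K.

Lemma integrable_moment l :
  mu.-integrable setT (EFin \o (fun r => K r * (1 + `|r| ^+ l))).
Proof.
have [_ _ iK] := mK.
rewrite (_ : _ \o _ = (EFin \o (fun r => (K r * `|r| ^+ 0)%R)) \+
                      (EFin \o (fun r => (K r * `|r| ^+ l)%R)))%E.
  exact: integrableD.
by apply/funext => r; rewrite /= -EFinD -mulrDr expr0.
Qed.

Lemma integrable_kernelM h C l : measurable_fun setT h ->
  (forall r, `|h r| <= C * (1 + `|r| ^+ l)) ->
  mu.-integrable setT (EFin \o (fun r => K r * h r)).
Proof.
move=> mh hC; have [mK' K0 _] := mK.
have I2 : mu.-integrable setT (EFin \o (fun r => C * (K r * (1 + `|r| ^+ l)))).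
  exact: (integrableZl measurableT C (integrable_moment l)).
apply: (le_integrable _ _ _ I2) => //.
  by apply/measurable_EFinP; exact: measurable_funM.
move=> r _; rewrite /= lee_fin normrM (ger0_norm (K0 r)) mulrCA.
rewrite (le_trans _ (ler_norm _))// ler_wpM2l//; exact: hC.
Qed.

Lemma le_Rintegral_kernel h C l : measurable_fun setT h ->
  (forall r, `|h r| <= C * (1 + `|r| ^+ l)) ->
  `|\int[mu]_r (K r * h r)| <= C * moment K l.
Proof.
move=> mh hC; have [mK' K0 _] := mK.
have I1 := integrable_kernelM mh hC.
apply: (le_trans (le_normr_Rintegral _ I1)) => //.
rewrite /moment -RintegralZl//; last exact: integrable_moment.
apply: le_Rintegral => //.
- exact: (integrable_norm I1).
- exact: (integrableZl measurableT C (integrable_moment l)).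
- by move=> r _; rewrite normrM (ger0_norm (K0 r)) mulrCA ler_wpM2l.
Qed.

Lemma moment_ge0 l : 0 <= moment K l.
Proof.
have [_ K0 _] := mK.
by apply: Rintegral_ge0 => r _; rewrite mulr_ge0// weight_ge0.
Qed.

Lemma measurable_shift g x s : continuous g ->
  measurable_fun setT (fun r => g (x - s * r)).
Proof.
move=> cg; apply: continuous_measurable_fun => r.
apply: (@continuous_comp _ _ _ (fun r => x - s * r) g); last exact: cg.
apply: cvgB; first exact: cvg_cst.
by apply: cvgM; [exact: cvg_cst|exact: cvg_id].
Qed.

Lemma integrable_avg g M s x : continuous g -> (forall y, `|g y| <= M) ->
  mu.-integrable setT (EFin \o (fun r => K r * g (x - s * r))).
Proof.
move=> cg gM.
apply: (@integrable_kernelM (fun r => g (x - s * r)) M 0).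
  exact: measurable_shift.
have M0 : 0 <= M := le_trans (normr_ge0 _) (gM 0).
by move=> r; rewrite (le_trans (gM _))// ler_peMr// weight_ge1.
Qed.

(** Here [x = y + s * r], and [weight_submul] moves the weight from [x] to [y]
at the price of a polynomial in [r]. *)
Lemma weight_avg g M l s x y r : `|(1 + `|y| ^+ l) * g y| <= M -> y = x - s * r ->
  (1 + `|x| ^+ l) * `|g y| <= 2 ^+ l * M * (1 + `|s| ^+ l) * (1 + `|r| ^+ l).
Proof.
move=> gM yE.
have M0 : 0 <= M := le_trans (normr_ge0 _) gM.
have xE : x = y + s * r by rewrite yE subrK.
have H := weight_submul l y (s * r); rewrite -xE in H.
apply: (le_trans (ler_wpM2r (normr_ge0 _) H)).
rewrite [leLHS](_ : _ = 2 ^+ l * ((1 + `|y| ^+ l) * `|g y|) * (1 + `|s * r| ^+ l));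
  last by ring.
have e0 : 0 <= 2 ^+ l :> R by exact: exprn_ge0.
rewrite -[leRHS]mulrA; apply: ler_pM.
- by rewrite !mulr_ge0// weight_ge0.
- exact: weight_ge0.
- rewrite ler_wpM2l//; move: gM; rewrite normrM ger0_norm//; exact: weight_ge0.
- rewrite normrM exprMn.
  have : 0 <= `|s| ^+ l by exact: exprn_ge0.
  have : 0 <= `|r| ^+ l by exact: exprn_ge0.
  set a := _ ^+ l; set b := _ ^+ l; nra.
Qed.

Lemma avg_bound g M l s x : continuous g ->
  (forall y, `|(1 + `|y| ^+ l) * g y| <= M) ->
  `|(1 + `|x| ^+ l) * avg K s g x| <= 2 ^+ l * M * (1 + `|s| ^+ l) * moment K l.
Proof.
move=> cg gM; have W0 := weight_ge0 l x.
pose h r := (1 + `|x| ^+ l) * g (x - s * r).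
have mh : measurable_fun setT h.
  by apply: measurable_funM => //; exact: measurable_shift.
have bh r : `|h r| <= 2 ^+ l * M * (1 + `|s| ^+ l) * (1 + `|r| ^+ l).
  by rewrite /h normrM ger0_norm//; apply: (weight_avg (gM _)).
have := le_Rintegral_kernel mh bh.
have I : mu.-integrable setT (EFin \o (fun r => K r * g (x - s * r))).
  apply: (@integrable_avg _ M) => // y; apply: le_trans (gM y).
  by rewrite normrM ler_peMl// ger0_norm ?weight_ge0 ?weight_ge1.
rewrite /avg -(RintegralZl _ measurableT I).
by under [in X in _ -> X]eq_Rintegral => r _ do rewrite mulrCA.
Qed.

(** The mean value theorem gives [g (x - s r) - g (x - t r)] as [(t - s) r]
times [g' (x - c r)] with [c] between [s] and [t]; the extra factor [r] costs
one more moment. *)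
Lemma avg_lipschitz g (g' : R -> R) M B l S s t x :
  (forall y, is_derive y (1 : R) g (g' y)) ->
  (forall y, `|g y| <= B) ->
  (forall y, `|(1 + `|y| ^+ l) * g' y| <= M) ->
  `|s| <= S -> `|t| <= S ->
  `|(1 + `|x| ^+ l) * (avg K s g x - avg K t g x)| <=
  2 * (2 ^+ l * M * (1 + S ^+ l) * moment K l.+1) * `|s - t|.
Proof.
move=> dg gB gM sS tS; have W0 := weight_ge0 l x.
have M0 : 0 <= M := le_trans (normr_ge0 _) (gM 0).
have S0 : 0 <= S := le_trans (normr_ge0 _) sS.
have cg : continuous g.
  move=> y; apply: differentiable_continuous.
  by apply/derivable1_diffP; have [] := dg y.
pose h r := (1 + `|x| ^+ l) * (g (x - s * r) - g (x - t * r)).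
have mh : measurable_fun setT h.
  apply: measurable_funM => //.
  by apply: measurable_funB; exact: measurable_shift.
pose C := 2 * (2 ^+ l * M * (1 + S ^+ l)) * `|s - t|.
have bh r : `|h r| <= C * (1 + `|r| ^+ l.+1).
  have [c [cS E]] : exists c, `|c| <= S /\
      `|g (x - s * r) - g (x - t * r)| = `|g' (x - c * r)| * (`|s - t| * `|r|).
    have xs c : `|x - (x - c * r)| = `|c| * `|r| by rewrite subKr normrM.
    move: s t sS tS {h mh C}.
    suff W (s t : R) : `|s| <= S -> `|t| <= S -> x - s * r < x - t * r ->
        exists c, `|c| <= S /\
          `|g (x - s * r) - g (x - t * r)| = `|g' (x - c * r)| * (`|s - t| * `|r|).
      move=> s t sS tS.
      have [uv|vu|uv] := ltgtP (x - s * r) (x - t * r).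
      - exact: W.
      - have [c [cS E]] := W t s tS sS vu; exists c; split=> //.
        by rewrite distrC E (distrC t).
      - exists s; split=> //; rewrite uv subrr normr0 -normrM mulrBl.
        rewrite (_ : s * r - t * r = (x - t * r) - (x - s * r)); last by ring.
        by rewrite uv subrr normr0 mulr0.
    move=> sS tS uv.
    have [|z zuv E] := @MVT _ g g' (x - s * r) (x - t * r) uv (fun z _ => dg z).
      exact: continuous_subspaceT.
    have r0 : r != 0 by apply/eqP => r0; move: uv; rewrite r0 !mulr0 ltxx.
    exists ((x - z) / r); rewrite divfK// subKr; split.
      rewrite normrM normfV ler_pdivrMr ?normr_gt0//.
      have sr : `|s * r| <= S * `|r| by rewrite normrM ler_wpM2r.
      have tr : `|t * r| <= S * `|r| by rewrite normrM ler_wpM2r.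
      move: sr tr zuv; rewrite in_itv/= !ler_norml; lra.
    rewrite distrC E normrM -(normrM (s - t)); congr (_ * `|_|); ring.
  rewrite /h normrM ger0_norm// E [leLHS]mulrA.
  have H := @weight_avg g' M l c x (x - c * r) r (gM _) erefl.
  have H2 : (1 + `|x| ^+ l) * `|g' (x - c * r)| <= 2 ^+ l * M * (1 + S ^+ l) * (1 + `|r| ^+ l).
    apply: (le_trans H); rewrite ler_wpM2r ?weight_ge0// ler_wpM2l ?lerD2l//.
      by rewrite mulr_ge0// exprn_ge0.
    by rewrite lerXn2r ?nnegrE.
  have sr0 : 0 <= `|s - t| * `|r| by rewrite mulr_ge0.
  apply: (le_trans (ler_wpM2r sr0 H2)).
  rewrite [leLHS](_ : _ = 2 ^+ l * M * (1 + S ^+ l) * `|s - t| *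
    ((1 + `|r| ^+ l) * `|r|)); last by ring.
  rewrite [leRHS](_ : _ = 2 ^+ l * M * (1 + S ^+ l) * `|s - t| *
    (2 * (1 + `|r| ^+ l.+1))); last by rewrite /C; ring.
  rewrite ler_wpM2l//.
    by rewrite !mulr_ge0// addr_ge0// exprn_ge0.
  rewrite mulrDl mul1r -exprSr.
  have r1 : `|r| <= 1 + `|r| ^+ l.+1.
    have [r1|r1] := leP `|r| 1; first by rewrite ler_wpDr ?exprn_ge0.
    by rewrite ler_wpDl// ler_eXnr// ltW.
  by rewrite mulrDr mulr1; move: r1; have := exprn_ge0 l.+1 (normr_ge0 r); lra.
have := le_Rintegral_kernel mh bh.
rewrite [X in _ <= X](_ : _ =
    2 * (2 ^+ l * M * (1 + S ^+ l) * moment K l.+1) * `|s - t|); last first.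
  by rewrite /C; ring.
have I1 := integrable_avg s x cg gB; have I2 := integrable_avg t x cg gB.
have I3 : mu.-integrable setT
    (EFin \o (fun r => K r * g (x - s * r) - K r * g (x - t * r))).
  have := integrableB measurableT I1 I2.
  by apply: eq_integrable => // r _; rewrite /= EFinB.
rewrite /avg -(RintegralB measurableT I1 I2) -(RintegralZl _ measurableT I3).
by under [in X in _ -> X]eq_Rintegral => r _ do rewrite -mulrBr mulrCA.
Qed.

Lemma is_derive_avg g (g' : R -> R) B M s x :
  (forall y, is_derive y (1 : R) g (g' y)) -> continuous g' ->
  (forall y, `|g y| <= B) -> (forall y, `|g' y| <= M) ->
  is_derive x (1 : R) (avg K s g) (avg K s g' x).
Proof.
move=> dg cg' gB gM; have [mK' K0 _] := mK.
have cg : continuous g.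
  move=> y; apply: differentiable_continuous.
  by apply/derivable1_diffP; have [] := dg y.
pose F x r := K r * g (x - s * r).
have dF y r : is_derive y (1 : R) (F ^~ r) (K r * g' (y - s * r)).
  rewrite /F; apply: is_deriveZ.
  have := @is_derive1_comp _ g (fun y => y - s * r) y _ 1 (dg (y - s * r)).
  rewrite mulr1; apply.
  by have := @is_deriveD _ _ _ id (cst (- (s * r))) y 1 1 0; rewrite addr0; apply.
have I1 y : `]x - 1, x + 1[%classic y -> mu.-integrable setT (EFin \o F y).
  by move=> _; exact: (integrable_avg s y cg gB).
have D1 y r : `]x - 1, x + 1[%classic y -> setT r -> derivable (F ^~ r) y 1.
  by move=> _ _; have [] := dF y r.
have IG : mu.-integrable setT (EFin \o (fun r => K r * M)).
  have M0 : 0 <= M := le_trans (normr_ge0 _) (gM 0).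
  apply: (@integrable_kernelM (cst M) M 0) => // r.
  by rewrite /= ger0_norm// ler_peMr// weight_ge1.
have G0 r : 0 <= K r * M by rewrite mulr_ge0// (le_trans (normr_ge0 _) (gM 0)).
have GU y r : `]x - 1, x + 1[%classic y -> setT r -> `|partial1of2 F y r| <= K r * M.
  move=> _ _; rewrite partial1of2E; have [_ ->] := dF y r.
  by rewrite normrM ger0_norm// ler_wpM2l.
have Ix : `]x - 1, x + 1[%classic x by rewrite /= in_itv/= ltrBlDr !ltrDl ltr01.
split; first exact: (derivable_under_integral measurableT Ix I1 D1 G0 IG GU).
have := differentiation_under_integral measurableT Ix I1 D1 G0 IG GU.
rewrite derive1E => ->; apply: eq_Rintegral => r _.
by rewrite partial1of2E; have [_ ->] := dF x r.
Qed.

Lemma schwartz_bounded g k : schwartz_on setT g ->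
  exists M, forall y, `|derive1n k g y| <= M.
Proof.
move=> sg; have [M _ gM] := schwartz_on_bound k 0 sg.
exists M => y; apply: le_trans (gM y I).
by rewrite normrM ler_peMl// ger0_norm ?weight_ge0 ?weight_ge1.
Qed.

(** Averaging commutes with differentiation, so that the bound on an average
of a bounded weighted function serves for every derivative. *)
Lemma schwartz_avg s g : schwartz_on setT g ->
  schwartz_on setT (avg K s g) /\
  forall k, derive1n k (avg K s g) = avg K s (derive1n k g).
Proof.
move=> sg; pose G k := avg K s (derive1n k g).
have dG k x : setT x -> is_derive x (1 : R) (G k) (G k.+1 x).
  move=> _; have [B gB] := schwartz_bounded k sg.
  have [M gM] := schwartz_bounded k.+1 sg.
  apply: (is_derive_avg _ _ _ _ gB gM) => [y|].
    exact: (smooth_is_derive _ sg.1).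
  exact: schwartz_continuous.
have [_ E] := derive1n_tower openT dG.
split; last by move=> k; apply/funext => x; rewrite E ?inE.
apply: (schwartz_towerP openT dG) => k l.
have [M _ gM] := schwartz_on_bound k l sg.
exists (2 ^+ l * M * (1 + `|s| ^+ l) * moment K l) => x _.
by apply: avg_bound => [|y]; [exact: schwartz_continuous|exact: gM].
Qed.

End kernel.
End averages.

(** * Locally Lipschitz paths of Schwartz functions *)

Section paths.
Context {R : realType}.
Implicit Types (f g K : R -> R) (p q : R -> R -> R) (k l : nat) (s t x y r : R).

Definition lip_path p : Prop :=
  (forall s, schwartz_on setT (p s)) /\
  forall k l (S : R), exists2 C, 0 <= C & forall s t, `|s| <= S -> `|t| <= S ->
    forall x, `|(1 + `|x| ^+ l) * (derive1n k (p s) x - derive1n k (p t) x)|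
       <= C * `|s - t|.

Lemma lip_path_avg K g : moment_kernel K -> schwartz_on setT g ->
  lip_path (fun s => avg K s g).
Proof.
move=> mK sg; split=> [s|k l S]; first exact: (schwartz_avg mK s sg).1.
have [B gB] := schwartz_bounded k sg.
have [M M0 gM] := schwartz_on_bound k.+1 l sg.
have [S0|S0] := ltP S 0.
  by exists 0 => // s t sS; have := le_lt_trans sS S0; rewrite ltNge normr_ge0.
exists (2 * (2 ^+ l * M * (1 + S ^+ l) * moment K l.+1)).
  by rewrite !mulr_ge0 ?moment_ge0// addr_ge0// exprn_ge0.
move=> s t sS tS x.
rewrite (schwartz_avg mK s sg).2 (schwartz_avg mK t sg).2.
apply: (avg_lipschitz mK x _ gB _ sS tS) => y.
  exact: (smooth_is_derive _ sg.1).
exact: gM.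
Qed.

Lemma lip_path_lin a p q : lip_path p -> lip_path q ->
  lip_path (fun s => a *: p s + q s).
Proof.
move=> [sp Lp] [sq Lq]; split=> [s|k l S]; first exact: (schwartz_lin a openT).
have [C C0 pC] := Lp k l S; have [D D0 qD] := Lq k l S.
exists (`|a| * C + D) => [|s t sS tS x]; first by rewrite addr_ge0// mulr_ge0.
rewrite !(derive1n_lin a openT (sp _).1 (sq _).1) ?inE//.
rewrite [X in `|_ * X|](_ : _ = a * (derive1n k (p s) x - derive1n k (p t) x) +
  (derive1n k (q s) x - derive1n k (q t) x)); last first.
  by rewrite !fctE /GRing.scale/=; ring.
rewrite mulrDr (le_trans (ler_normD _ _))// [leRHS]mulrDl lerD ?qD//.
by rewrite mulrCA normrM -mulrA ler_wpM2l// pC.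
Qed.

Lemma lip_path_mirror p : lip_path p -> lip_path (fun s => mirror (p s)).
Proof.
move=> [sp Lp]; split=> [s|k l S]; first exact: schwartz_mirror.
have [C C0 pC] := Lp k l S; exists C => // s t sS tS x.
rewrite (derive1n_mirror k (sp s)) (derive1n_mirror k (sp t)).
by rewrite -mulrBr mulrCA normrMsign -{1}(normrN x) pC.
Qed.

Lemma avgB K s x f g B C : moment_kernel K -> continuous f -> continuous g ->
  (forall y, `|f y| <= B) -> (forall y, `|g y| <= C) ->
  avg K s (f - g) x = avg K s f x - avg K s g x.
Proof.
move=> mK cf cg fB gC.
rewrite /avg -(RintegralB measurableT (integrable_avg mK s x cf fB)
   (integrable_avg mK s x cg gC)).
by apply: eq_Rintegral => r _; rewrite -mulrBr.
Qed.

Lemma avgZ K s x a f B : moment_kernel K -> continuous f ->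
  (forall y, `|f y| <= B) -> avg K s (a *: f) x = a * avg K s f x.
Proof.
move=> mK cf fB.
rewrite /avg -(RintegralZl _ measurableT (integrable_avg mK s x cf fB)).
by apply: eq_Rintegral => r _; rewrite mulrCA.
Qed.

(** For a fixed scale, averaging is a linear operator that is bounded in each
seminorm. *)
Lemma lip_path_postavg K c p : moment_kernel K -> lip_path p ->
  lip_path (fun s => avg K c (p s)).
Proof.
move=> mK [sp Lp]; split=> [s|k l S]; first exact: (schwartz_avg mK c (sp s)).1.
have [C C0 pC] := Lp k l S.
exists (2 ^+ l * C * (1 + `|c| ^+ l) * moment K l).
  by rewrite !mulr_ge0 ?moment_ge0 ?weight_ge0.
move=> s t sS tS x.
have [B sB] := schwartz_bounded k (sp s); have [D tD] := schwartz_bounded k (sp t).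
have cs := @schwartz_continuous _ _ k (sp s).
have ct := @schwartz_continuous _ _ k (sp t).
rewrite (schwartz_avg mK c (sp s)).2 (schwartz_avg mK c (sp t)).2.
rewrite -(avgB c x mK cs ct sB tD).
rewrite [leRHS](_ : _ = 2 ^+ l * (C * `|s - t|) * (1 + `|c| ^+ l) * moment K l); last by ring.
apply: (avg_bound mK) => [y|y]; last exact: pC.
by apply: cvgB; [exact: cs|exact: ct].
Qed.

Lemma avg_mirror K s g B : moment_kernel K -> (forall r, K (- r) = K r) ->
  continuous g -> (forall y, `|g y| <= B) ->
  avg K s (mirror g) = mirror (avg K s g).
Proof.
move=> mK KN cg gB; apply/funext => x; rewrite /mirror /avg.
rewrite [RHS](@Rintegral_affine _ (-1) 0) ?oppr_eq0 ?oner_eq0//; last first.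
  exact: (integrable_avg mK s (- x) cg gB).
rewrite normrN1 mul1r; apply: eq_Rintegral => r _.
by rewrite addr0 mulN1r KN; congr (_ * g _); ring.
Qed.

End paths.

(** * Exponential and Gaussian kernels *)

Section kernels.
Context {R : realType}.
Local Notation mu := (@lebesgue_measure R).
Implicit Types (f g h K : R -> R) (k l : nat) (s t x y r : R).

Lemma expR_dominates_powers l c : 0 < c ->
  exists2 C, 0 <= C & forall x, 0 <= x -> x ^+ l <= C * expR (c * x).
Proof.
move=> c0; case: l => [|l].
  exists 1 => // x x0; rewrite expr0 mul1r -expR0 ler_expR.
  by rewrite mulr_ge0// ltW.
exists (l.+1`!%:R / c ^+ l.+1) => [|x x0].
  by rewrite divr_ge0// exprn_ge0// ltW.
have cx : 0 <= c * x by rewrite mulr_ge0// ltW.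
have := expR_ge1Dxn l cx.
have f0 : 0 < l.+1`!%:R :> R by rewrite ltr0n fact_gt0.
have cl : 0 < c ^+ l.+1 by rewrite exprn_gt0.
move=> H; rewrite mulrAC ler_pdivlMr// mulrC -exprMn -ler_pdivrMl//.
by rewrite mulrC (le_trans _ H)// lerDr.
Qed.

Definition exp_kernel a r : R := if 0 <= r then expR (- (a * r)) else 0.

Lemma exp_kernelE a : 0 < a -> exp_kernel a = fun r => a^-1 * exponential_pdf a r.
Proof.
move=> a0; apply/funext => r; rewrite /exp_kernel /exponential_pdf patchE.
rewrite mem_setE in_itv/= andbT; case: ifP => _; last by rewrite mulr0.
by rewrite mulKf ?gt_eqF// mulNr.
Qed.

Lemma integrable_exp_kernel a : 0 < a ->
  mu.-integrable setT (EFin \o exp_kernel a).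
Proof.
move=> a0; rewrite exp_kernelE//.
exact: (integrableZl measurableT a^-1 (integrable_exponential_pdf a0)).
Qed.

Lemma measurable_exp_kernel a : 0 < a -> measurable_fun setT (exp_kernel a).
Proof.
move=> a0; have [/measurable_EFinP] := integrableP _ _ _ (integrable_exp_kernel a0).
by [].
Qed.

Lemma exp_kernel_ge0 a r : 0 <= exp_kernel a r.
Proof. by rewrite /exp_kernel; case: ifP => // _; exact: expR_ge0. Qed.

(** Polynomial factors are absorbed by a slightly slower exponential decay, so
that it suffices to compare with an integrable [K']. *)
Lemma moment_kernel_dominated K K' : measurable_fun setT K ->
  (forall r, 0 <= K r) -> mu.-integrable setT (EFin \o K') ->
  (forall l, exists C, forall r, K r * `|r| ^+ l <= C * K' r) ->
  moment_kernel K.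
Proof.
move=> mK K0 iK' KK'; split=> // l; have [C HC] := KK' l.
have I := integrableZl measurableT C iK'.
apply: (le_integrable _ _ _ I) => //.
  apply/measurable_EFinP; apply: measurable_funM => //.
  apply: measurable_funX; apply: continuous_measurable_fun.
  exact: norm_continuous.
move=> r _; rewrite /= lee_fin ger0_norm ?mulr_ge0 ?exprn_ge0//.
by rewrite (le_trans (HC r))// ler_norm.
Qed.

Lemma exp_kernel_moments a : 0 < a -> moment_kernel (exp_kernel a).
Proof.
move=> a0; have a2 : 0 < a / 2 by rewrite divr_gt0.
apply: (moment_kernel_dominated _ _ (integrable_exp_kernel a2)) => [||l].
- exact: measurable_exp_kernel.
- exact: exp_kernel_ge0.
have [C C0 HC] := expR_dominates_powers l a2.
exists C => r; rewrite /exp_kernel; case: (leP 0 r) => r0; last by rewrite mul0r mulr0.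
rewrite ger0_norm// mulrC (le_trans (ler_wpM2r (expR_ge0 _) (HC r r0)))//.
rewrite -[leLHS]mulrA -expRD ler_wpM2l// ler_expR; lra.
Qed.

Lemma phi_ge0 t x : 0 <= phi t x.
Proof. by rewrite /phi mulr_ge0 ?invr_ge0 ?sqrtr_ge0// expR_ge0. Qed.

Lemma phiN t x : phi t (- x) = phi t x.
Proof. by rewrite /phi sqrrN. Qed.

Lemma phi_normal t : 0 < t -> phi t = normal_pdf 0 (Num.sqrt (2 * t)).
Proof.
move=> t0; have t2 : 0 < 2 * t by rewrite mulr_gt0.
apply/funext => x; rewrite normal_pdfE ?gt_eqF ?sqrtr_gt0//.
rewrite /normal_peak /normal_fun /phi sqr_sqrtr ?ltW// subr0.
congr ((Num.sqrt _)^-1 * expR (_ / _)); ring.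
Qed.

Lemma continuous_phi t : 0 < t -> continuous (phi t : R -> R).
Proof.
move=> t0; rewrite phi_normal//; apply: continuous_normal_pdf.
by rewrite gt_eqF// sqrtr_gt0 mulr_gt0.
Qed.

Lemma integrable_phi t : 0 < t -> mu.-integrable setT (EFin \o phi t).
Proof. by move=> t0; rewrite phi_normal//; exact: integrable_normal_pdf. Qed.

Lemma Rintegral_phi t : 0 < t -> \int[mu]_r phi t r = 1.
Proof.
by move=> t0; rewrite phi_normal// /Rintegral integral_normal_pdf.
Qed.

(** Powers are dominated by [expR `|r|], and completing the square in [`|r| <=
2 t + r ^+ 2 / (8 t)] turns the Gaussian of time [t] into that of time [2 t].
*)
Lemma gauss_moments t : 0 < t -> moment_kernel (phi t : R -> R).
Proof.
move=> t0; have t2 : 0 < 2 * t by rewrite mulr_gt0.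
apply: (moment_kernel_dominated _ (phi_ge0 t) (integrable_phi t2)) => [|l].
  by apply: continuous_measurable_fun; exact: continuous_phi.
have [C C0 HC] := expR_dominates_powers l (@ltr01 R).
pose c : R := (Num.sqrt (4 * pi * t))^-1; pose c2 : R := (Num.sqrt (4 * pi * (2 * t)))^-1.
have c0 : 0 <= c by rewrite invr_ge0 sqrtr_ge0.
have c20 : 0 < c2 by rewrite invr_gt0 sqrtr_gt0 !mulr_gt0// pi_gt0.
exists (c * C * expR (2 * t) / c2) => r; rewrite /phi -/c -/c2.
rewrite [leRHS](_ : _ = c * (C * (expR (2 * t) * 
    expR (- r ^+ 2 / (4 * (2 * t)))))); last first.
  by field; rewrite !gt_eqF.
rewrite -mulrA ler_wpM2l// mulrC.
rewrite (le_trans (ler_wpM2r (expR_ge0 _) (HC _ (normr_ge0 r))))//.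
rewrite -mulrA ler_wpM2l// -!expRD ler_expR mul1r -(real_normK (num_real r)).
set u := `|r|; have : 0 <= (u - 4 * t) ^+ 2 / (8 * t).
  by rewrite divr_ge0 ?sqr_ge0// mulr_ge0// ltW.
rewrite (_ : _ / (8 * t) = 2 * t - u + u ^+ 2 / (8 * t)); last by field; rewrite gt_eqF.
rewrite (_ : - u ^+ 2 / (4 * t) = - 2 * (u ^+ 2 / (8 * t))); last by field; rewrite gt_eqF.
rewrite (_ : - u ^+ 2 / (4 * (2 * t)) = - (u ^+ 2 / (8 * t))); last by field; rewrite gt_eqF.
by set z := _ / _; lra.
Qed.

Lemma phi_scale t r : 0 < t -> Num.sqrt t * phi t (Num.sqrt t * r) = phi 1 r.
Proof.
move=> t0; have st : 0 < Num.sqrt t by rewrite sqrtr_gt0.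
rewrite /phi exprMn sqr_sqrtr ?ltW// mulrA; congr (_ * expR _); last first.
  by field; rewrite gt_eqF.
rewrite mulr1 (sqrtrM t) ?mulr_ge0 ?pi_ge0//.
by field; rewrite !gt_eqF// sqrtr_gt0 mulr_gt0// pi_gt0.
Qed.

Lemma integrable_heat t x g B : 0 < t -> continuous g -> (forall y, `|g y| <= B) ->
  mu.-integrable setT (EFin \o (fun y => phi t (x - y) * g y)).
Proof.
move=> t0 cg gB; have st : 0 < Num.sqrt t by rewrite sqrtr_gt0.
have I := integrable_avg (gauss_moments ltr01) (Num.sqrt t) x cg gB.
have := integrable_affine (x / Num.sqrt t) (_ : - (Num.sqrt t)^-1 != 0) I.
rewrite oppr_eq0 invr_eq0 gt_eqF// => /(_ isT).
move/(integrableZl measurableT (Num.sqrt t)^-1); apply: eq_integrable => // y _.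
rewrite /= -EFinM; congr (_%:E).
set r := - _ * y + _.
have -> : x - y = Num.sqrt t * r by rewrite /r; field; rewrite gt_eqF.
rewrite -(phi_scale r t0) mulrA mulKf ?gt_eqF//; congr (_ * g _).
by rewrite /r; field; rewrite gt_eqF.
Qed.

(** The substitution [y = x - sqrt t * r] shows that the heat flow averages
translates against a fixed kernel, which makes sense at [t = 0] too. *)
Lemma heat_avg t x g B : 0 < t -> continuous g -> (forall y, `|g y| <= B) ->
  \int[mu]_y (phi t (x - y) * g y) = avg (phi 1) (Num.sqrt t) g x.
Proof.
move=> t0 cg gB; have st : 0 < Num.sqrt t by rewrite sqrtr_gt0.
have st0 : - Num.sqrt t != 0 by rewrite oppr_eq0 gt_eqF.
have I := integrable_heat x t0 cg gB.
rewrite (Rintegral_affine x st0 I) normrN gtr0_norm// -RintegralZl//.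
  apply: eq_Rintegral => r _; rewrite -(phi_scale r t0) mulrA.
  by congr (_ * phi t _ * g _); ring.
exact: (integrable_affine x st0 I).
Qed.

Lemma avg0 g : avg (phi 1) 0 g = g.
Proof.
apply/funext => x; rewrite /avg.
under eq_Rintegral do rewrite mul0r subr0.
by rewrite RintegralZr ?Rintegral_phi ?mul1r//; exact: integrable_phi.
Qed.

Lemma Rintegral_fold h : mu.-integrable setT (EFin \o h) ->
  \int[mu]_y h y = \int[mu]_(y in `]0, +oo[) (h y + h (- y)).
Proof.
move=> Ih.
have IhN : mu.-integrable setT (EFin \o (fun y => h (- y))).
  have := integrable_affine 0 (_ : -1 != 0 :> R) Ih.
  rewrite oppr_eq0 oner_eq0 => /(_ isT); apply: eq_integrable => // y _.
  by rewrite /= addr0 mulN1r.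
have m0 : measurable (`]0, +oo[%classic : set R) by [].
rewrite RintegralD//; [|exact: (integrableS _ _ _ Ih)|exact: (integrableS _ _ _ IhN)].
rewrite -(setUv `]0, +oo[%classic) Rintegral_setU//; last 3 first.
- exact: measurableC.
- by rewrite setUv.
- exact/disj_setPCl.
congr (_ + _); rewrite Rintegral_mkcond (@Rintegral_affine _ (-1) 0); last 2 first.
- by rewrite oppr_eq0 oner_eq0.
- by rewrite -restrict_EFin; apply/integrable_restrict => //;
  rewrite ?setTI ?setIT; try exact: measurableC; apply: integrableS Ih => //; exact: measurableC.
rewrite normrN1 mul1r Rintegral_itv_obnd_cbnd; last exact: (integrableS _ _ _ IhN).
rewrite [RHS]Rintegral_mkcond; apply: eq_Rintegral => y _.
rewrite !patchE addr0 mulN1r; congr (if _ then _ else _).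
apply/idP/idP; rewrite !inE/= !in_itv/= !andbT.
  by move/negP; rewrite -leNgt oppr_le0.
by move=> y0; apply/negP; rewrite -leNgt oppr_le0.
Qed.

End kernels.

(** * The exponential average inverts a first-order operator *)

Section kernel_identities.
Context {R : realType}.
Local Notation mu := (@lebesgue_measure R).
Implicit Types (f g h : R -> R) (k l : nat) (a s t x y z r : R).

Lemma is_derive_mul f g x (df dg : R) :
  is_derive x (1 : R) f df -> is_derive x (1 : R) g dg ->
  is_derive x (1 : R) (fun y => f y * g y) (df * g x + f x * dg).
Proof.
move=> Hf Hg; refine (is_derive_eq (is_deriveM Hf Hg) _).
by rewrite /GRing.scale/= addrC [g x * _]mulrC.
Qed.

Lemma is_derive_affine f (c b x d : R) : is_derive (c * x + b) (1 : R) f d ->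
  is_derive x (1 : R) (fun y => f (c * y + b)) (d * c).
Proof.
move=> Hf; apply: (@is_derive1_comp _ f (fun y => c * y + b)) => //.
have H1 := is_deriveZ c (is_derive_id x (1 : R)).
have H2 := is_derive_cst b x (1 : R).
refine (is_derive_eq (is_deriveD H1 H2) _).
by rewrite addr0 /GRing.scale/= mulr1.
Qed.

Lemma is_derive_continuous f x (d : R) : is_derive x (1 : R) f d -> {for x, continuous f}.
Proof.
by move=> [+ _] => /derivable1_diffP; exact: differentiable_continuous.
Qed.

(** The point 0 is negligible; this is used to change the value at 0 of the
even part of a test function. *)
Lemma Rintegral_eq_punctured f g : measurable_fun setT g ->
  {in punctured, f =1 g} -> \int[mu]_x f x = \int[mu]_x g x.
Proof.
move=> mg fg.
have E : f = g \+ (fun x => (f 0 - g 0) * \1_[set 0] x).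
  apply/funext => x /=; rewrite indicE; have [->|x0] := eqVneq x 0.
    by rewrite mem_set// mulr1 addrC subrK.
  by rewrite memNset ?mulr0 ?addr0 ?fg ?inE//= => /eqP; apply/negP.
have mf : measurable_fun setT f.
  by rewrite E; apply: measurable_funD => //; apply: measurable_funM.
rewrite /Rintegral; congr fine; apply: ae_eq_integral => //.
- exact/measurable_EFinP.
- exact/measurable_EFinP.
exists [set 0]; split=> //; first exact: lebesgue_measure_set1.
move=> x /= /not_implyP[_ H]; apply: contrapT => x0; apply: H.
by rewrite fg// inE; apply/eqP.
Qed.

Lemma cvg_expRN_pinfty a : 0 < a -> expR (- (a * x)) @[x --> +oo] --> (0 : R).
Proof.
move=> a0; apply: (@cvg_comp _ _ _ (fun x => a * x) (fun z => expR (- z)) _ (pinfty_nbhs R)).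
  exact: gt0_cvgMry.
exact: cvgr_expR.
Qed.

Lemma cvg_bounded_mul0 (F : set_system R) (FF : Filter F) f g B :
  (\forall x \near F, `|f x| <= B) -> g x @[x --> F] --> 0 ->
  f x * g x @[x --> F] --> 0.
Proof.
move=> fB g0; apply: norm_cvg0.
apply: (@squeeze_cvgr _ _ _ _ (cst 0) (fun x => B * `|g x|)).
- apply: filterS fB => x fx; rewrite normr_ge0/= normrM ler_wpM2r//.
- exact: cvg_cst.
- rewrite -[X in _ --> X](mulr0 B); apply: cvgMr.
  by rewrite -[X in _ --> X](@normr0 R R); exact: cvg_norm.
Qed.

Lemma avg_exp_kernelE a x g : 0 < a -> continuous g ->
  avg (exp_kernel a) (-1) g x =
  \int[mu]_(r in `[0, +oo[) (expR (- (a * r)) * g (x + r)).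
Proof.
move=> a0 cg; rewrite [RHS]Rintegral_mkcond; apply: eq_Rintegral => r _.
rewrite patchE /exp_kernel mem_setE in_itv/= andbT mulN1r opprK.
by case: ifP => // _; rewrite mul0r.
Qed.

(** The integrand is the derivative of [r |-> expR (- a r) * f (x + r)] on the
right half-line, a function that vanishes at infinity. Thus the exponential
average is, up to sign, the inverse of [f |-> f' - a f] among bounded
functions. As [f] is only considered to the right of [x], the lemma covers
functions that are not smooth at 0. *)
Lemma avg_exp_kernel_ftc a x f (f' : R -> R) g B B' : 0 < a ->
  (forall y, x <= y -> is_derive y (1 : R) f (f' y)) ->
  (forall y, x <= y -> `|f y| <= B') ->
  continuous g -> (forall y, `|g y| <= B) ->
  (forall y, x < y -> g y = f' y - a * f y) ->
  avg (exp_kernel a) (-1) g x = - f x.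
Proof.
move=> a0 df fB cg gB gE.
rewrite avg_exp_kernelE//.
pose F r := f (1 * r + x) * expR (- (a * r)).
have dF r : 0 <= r -> is_derive r (1 : R) F
    (expR (- (a * r)) * (f' (x + r) - a * f (x + r))).
  move=> r0.
  have H1 : is_derive r (1 : R) (fun r => f (1 * r + x)) (f' (x + r) * 1).
    by apply: is_derive_affine; rewrite mul1r addrC; apply: df; rewrite lerDl.
  have H2 : is_derive r (1 : R) (fun r => expR (- a * r + 0)) (expR (- a * r + 0) * - a).
    by apply: is_derive_affine; exact: is_derive_expR.
  have E : F = (fun r => f (1 * r + x) * expR (- a * r + 0)).
    by apply/funext => u; rewrite /F addr0 mulNr.
  rewrite E; refine (is_derive_eq (is_derive_mul H1 H2) _).
  by rewrite addr0 mulNr mul1r (addrC r); ring.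
have cexp r : {for r, continuous (fun r : R => expR (- (a * r)))}.
  apply: (@continuous_comp _ _ _ (fun r : R => - (a * r)) expR); last exact: continuous_expR.
  by apply: cvgN; apply: cvgM; [exact: cvg_cst|exact: cvg_id].
have I : mu.-integrable `]0, +oo[ (EFin \o (fun r => expR (- (a * r)) * g (x + r))).
  have I0 := integrable_avg (exp_kernel_moments a0) (-1) x cg gB.
  have : mu.-integrable `]0, +oo[
      (EFin \o (fun r => exp_kernel a r * g (x - -1 * r))).
    exact: (integrableS _ _ _ I0).
  apply: eq_integrable => // r; rewrite inE/= in_itv/= andbT => r0.
  by rewrite /exp_kernel ltW// mulN1r opprK.
rewrite -Rintegral_itv_obnd_cbnd//.
have D1 r : 0 < r -> is_derive r (1 : R) F (expR (- (a * r)) * g (x + r)).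
  by move=> r0; rewrite gE ?ltrDl//; apply: dF; exact: ltW.
have D2 r : 0 < r -> {for r, continuous (fun r => expR (- (a * r)) * g (x + r))}.
  move=> r0; apply: cvgM; first exact: cexp.
  apply: (@continuous_comp _ _ _ (fun r : R => x + r) g); last exact: cg.
  by apply: cvgD; [exact: cvg_cst|exact: cvg_id].
have D3 : F r @[r --> 0^'+] --> F 0.
  by apply: cvg_at_right_filter; exact: is_derive_continuous (dF 0 (lexx 0)).
have D4 : F r @[r --> +oo] --> (0 : R).
  apply: (@cvg_bounded_mul0 _ _ _ _ B') => //; last exact: cvg_expRN_pinfty.
  near=> r; apply: fB; rewrite mul1r lerDr.
  by near: r; exact: nbhs_pinfty_ge.
rewrite (Rintegral_itvoy_FTC D1 D2 I D3 D4).
by rewrite sub0r /F !mulr0 add0r oppr0 expR0 mulr1.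
Unshelve. all: by end_near. Qed.

(** The substitution [z = x + r] cancels the factor [expR (a * x)] of the
explicit formula of the semigroup. *)
Lemma half_line_exp_integral a x g B : 0 < a -> continuous g ->
  (forall y, `|g y| <= B) ->
  expR (a * x) * \int[mu]_(z in `[x, +oo[) (expR (- (a * z)) * g z) =
  avg (exp_kernel a) (-1) g x.
Proof.
move=> a0 cg gB.
pose h z := exp_kernel a (z - x) * g z.
have Ih : mu.-integrable setT (EFin \o h).
  have := integrable_avg (exp_kernel_moments a0) (-1) x cg gB.
  move/(integrable_affine (- x) (oner_neq0 R)); apply: eq_integrable => // z _.
  by rewrite /h /= mul1r mulN1r opprK addrCA subrr addr0.
have -> : \int[mu]_(z in `[x, +oo[) (expR (- (a * z)) * g z) =
    expR (- (a * x)) * \int[mu]_z h z.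
  rewrite -RintegralZl// Rintegral_mkcond; apply: eq_Rintegral => z _.
  rewrite patchE mem_setE in_itv/= andbT /h /exp_kernel subr_ge0.
  case: ifP => _; last by rewrite mul0r mulr0.
  by rewrite mulrA -expRD; congr (expR _ * _); ring.
rewrite mulrA -expRD subrr expR0 mul1r.
rewrite (@Rintegral_affine _ 1 x _ (oner_neq0 R) Ih) normr1 mul1r.
apply: eq_Rintegral => r _; rewrite /h mul1r addrK mulN1r opprK.
by rewrite addrC.
Qed.

Lemma is_derive_phi t x : 0 < t ->
  is_derive x (1 : R) (phi t) (- (x / (2 * t)) * phi t x).
Proof.
move=> t0.
have H1 : is_derive x (1 : R) (fun y : R => y * y) (1 * x + x * 1).
  by apply: is_derive_mul; exact: is_derive_id.
have H2 := is_deriveZ (- (4 * t)^-1) H1.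
have H3 := @is_derive1_comp _ expR _ x _ _ (is_derive_expR _) H2.
have H4 := is_deriveZ (Num.sqrt (4 * pi * t))^-1 H3.
rewrite (_ : phi t = (Num.sqrt (4 * pi * t))^-1 *:
    (expR \o (- (4 * t)^-1 *: (fun y : R => y * y)))).
  refine (is_derive_eq H4 _); rewrite /phi /GRing.scale/= /GRing.scale/=.
  rewrite (_ : - (4 * t)^-1 * (x * x) = - x ^+ 2 / (4 * t)); last by field; rewrite gt_eqF.
  by field; rewrite !gt_eqF// sqrtr_gt0 !mulr_gt0// pi_gt0.
apply/funext => y; rewrite /phi /GRing.scale/=; congr (_ * expR _).
by rewrite /GRing.scale/=; field; rewrite gt_eqF.
Qed.

End kernel_identities.

(** * The heat flow of even and odd functions on a half-line *)

Section half_line_parts.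
Context {R : realType}.
Local Notation mu := (@lebesgue_measure R).
Implicit Types (f g h w : R -> R) (k l : nat) (a s t x y z r : R).

Lemma integrable_lin (D : set R) c f g : measurable D ->
  mu.-integrable D (EFin \o f) -> mu.-integrable D (EFin \o g) ->
  mu.-integrable D (EFin \o (fun x => c * f x + g x)).
Proof.
move=> mD If Ig; have mD' : measurable (D : set (measurableTypeR R)) := mD.
have := integrableD mD' (integrableZl mD' c If) Ig.
by apply: eq_integrable.
Qed.

Lemma integrable_mul_bounded f g (B : R) : mu.-integrable setT (EFin \o f) ->
  (forall x, 0 < x -> {for x, continuous g}) -> (forall x, 0 < x -> `|g x| <= B) ->
  mu.-integrable `]0, +oo[ (EFin \o (fun x => f x * g x)).
Proof.
move=> If cg gB.
have mD : measurable (`]0, +oo[%classic : set (measurableTypeR R)) by [].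
have If0 : mu.-integrable `]0, +oo[ (EFin \o f) by exact: (integrableS _ _ _ If).
have mg : measurable_fun (`]0, +oo[%classic : set R) g.
  apply: open_continuous_measurable_fun; first exact: interval_open.
  by move=> x; rewrite inE/= in_itv/= andbT; exact: cg.
have [/measurable_EFinP mf _] := integrableP _ _ _ If0.
have I2 := integrableZl mD B (integrable_norm If0).
apply: (le_integrable _ _ _ I2) => //.
  by apply/measurable_EFinP; exact: measurable_funM.
move=> x /=; rewrite in_itv/= andbT => x0; rewrite lee_fin normrM mulrC.
rewrite (le_trans (ler_wpM2r _ (gB x x0)))//.
by rewrite (le_trans _ (ler_norm _)).
Qed.

Lemma integrable_shifts f z : mu.-integrable setT (EFin \o f) ->
  mu.-integrable setT (EFin \o (fun y => f (z - y))) /\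
  mu.-integrable setT (EFin \o (fun y => f (z + y))).
Proof.
move=> If; split.
  have := integrable_affine z (_ : -1 != 0 :> R) If.
  rewrite oppr_eq0 oner_eq0 => /(_ isT); apply: eq_integrable => // y _.
  by rewrite /= mulN1r addrC.
have := integrable_affine z (oner_neq0 R) If; apply: eq_integrable => // y _.
by rewrite /= mul1r addrC.
Qed.

Lemma integrable_id_phi t : 0 < t ->
  mu.-integrable setT (EFin \o (fun x => x * phi t x)).
Proof.
move=> t0; have [_ _ /(_ 1%N) I] := gauss_moments t0.
apply: (le_integrable _ _ _ I) => //.
  apply/measurable_EFinP; apply: measurable_funM => //.
  by apply: continuous_measurable_fun; exact: continuous_phi.
by move=> x _; rewrite /= lee_fin expr1 !normrM normr_id mulrC.
Qed.

Lemma cvg_phi_pinfty t : 0 < t -> phi t x @[x --> +oo] --> (0 : R).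
Proof.
move=> t0; pose c : R := (Num.sqrt (4 * pi * t))^-1.
have t4 : 0 < (4 * t)^-1 by rewrite invr_gt0 mulr_gt0.
have c0 : 0 <= c by rewrite invr_ge0 sqrtr_ge0.
have H := cvg_expRN_pinfty t4.
apply: (@squeeze_cvgr _ _ _ _ (cst 0) (fun x => c * expR (- ((4 * t)^-1 * x)))).
- near=> x; have x1 : 1 <= x by near: x; exact: nbhs_pinfty_ge.
  rewrite phi_ge0/= /phi -/c ler_wpM2l// ler_expR.
  rewrite -(ler_pM2l (_ : 0 < 4 * t)) ?mulr_gt0// mulrN mulVKf ?gt_eqF ?mulr_gt0//.
  rewrite mulrCA mulfV ?mulr1 ?gt_eqF ?mulr_gt0// lerN2 ler_eXnr//.
- exact: cvg_cst.
- by rewrite -[X in _ --> X](mulr0 c); exact: cvgMr.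
Unshelve. all: by end_near. Qed.

Lemma heat_odd_fold t z g B : 0 < t -> continuous g -> (forall y, `|g y| <= B) ->
  (forall y, g (- y) = - g y) ->
  avg (phi 1) (Num.sqrt t) g z =
  \int[mu]_(y in `]0, +oo[) ((phi t (z - y) - phi t (z + y)) * g y).
Proof.
move=> t0 cg gB gN; rewrite -(heat_avg z t0 cg gB).
rewrite Rintegral_fold; last exact: (integrable_heat z t0 cg gB).
by apply: eq_Rintegral => y _; rewrite opprK gN; ring.
Qed.

Lemma integrable_reflected_heat t z g B : 0 < t -> continuous g ->
  (forall y, `|g y| <= B) ->
  mu.-integrable `]0, +oo[ (EFin \o (fun y => (phi t (z - y) + phi t (z + y)) * g y)).
Proof.
move=> t0 cg gB; have [I1 I2] := integrable_shifts z (integrable_phi t0).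
apply: (@integrable_mul_bounded _ _ B) => [|y _|y _]; [|exact: cg|exact: gB].
have := integrable_lin 1 measurableT I1 I2; apply: eq_integrable => // y _.
by rewrite /= mul1r.
Qed.

Lemma heat_even_fold t z g B : 0 < t -> continuous g -> (forall y, `|g y| <= B) ->
  (forall y, g (- y) = g y) ->
  avg (phi 1) (Num.sqrt t) g z =
  \int[mu]_(y in `[0, +oo[) ((phi t (z - y) + phi t (z + y)) * g y).
Proof.
move=> t0 cg gB gN; rewrite -(heat_avg z t0 cg gB).
rewrite Rintegral_fold; last exact: (integrable_heat z t0 cg gB).
rewrite -Rintegral_itv_obnd_cbnd; last exact: integrable_reflected_heat gB.
by apply: eq_Rintegral => y _; rewrite opprK gN; ring.
Qed.

(** By oddness the average on the right is the integral over the half-line of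
[v = w' - 2 a w] against the Dirichlet kernel [d y = phi t (z - y) - phi t (z
+ y)]. The integrand on the left plus [d * v] is the derivative of [d * w],
and this product vanishes at 0, because [d] does, and at infinity. *)
Lemma heat_robin a t z w (w' : R -> R) v B C : 0 < t ->
  (forall y, 0 < y -> is_derive y (1 : R) w (w' y)) ->
  (forall y, 0 < y -> `|w y| <= C) ->
  continuous v -> (forall y, `|v y| <= B) -> (forall y, v (- y) = - v y) ->
  (forall y, 0 < y -> v y = w' y - 2 * a * w y) ->
  \int[mu]_(y in `[0, +oo[)
    (((z - y + 4 * a * t) / (2 * t) * phi t (z - y) +
      (z + y - 4 * a * t) / (2 * t) * phi t (z + y)) * w y) =
  - avg (phi 1) (Num.sqrt t) v z.
Proof.
move=> t0 dw wC cv vB vN vE.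
pose q y := (z - y + 4 * a * t) / (2 * t) * phi t (z - y) +
            (z + y - 4 * a * t) / (2 * t) * phi t (z + y).
pose d y := phi t (z - y) - phi t (z + y).
have [P1 P2] := integrable_shifts z (integrable_id_phi t0).
have [Q1 Q2] := integrable_shifts z (integrable_phi t0).
have Iq : mu.-integrable setT (EFin \o q).
  have := integrable_lin (2 * t)^-1 measurableT P1
    (integrable_lin (2 * t)^-1 measurableT P2
    (integrable_lin (2 * a) measurableT Q1
    (integrable_lin (- (2 * a)) measurableT Q2 (integrable0 mu setT)))).
  apply: eq_integrable => // y _.
  by rewrite /= /q; congr (_%:E); field; rewrite gt_eqF.
have Id : mu.-integrable setT (EFin \o d).
  have := integrable_lin (-1) measurableT Q2 Q1.
  by apply: eq_integrable => // y _; rewrite /= /d mulN1r addrC.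
have cw y : 0 < y -> {for y, continuous w}.
  by move=> y0; apply: is_derive_continuous (dw y y0).
have Iqw := integrable_mul_bounded Iq cw wC.
have Idv : mu.-integrable `]0, +oo[ (EFin \o (fun y => d y * v y)).
  by apply: (@integrable_mul_bounded _ _ B) => // y _; exact: cv.
rewrite (heat_odd_fold z t0 cv vB vN) -Rintegral_itv_obnd_cbnd//.
apply/eqP; rewrite -addr_eq0 -RintegralD//.
pose F y := d y * w y.
have dd y : is_derive y (1 : R) d ((z - y) / (2 * t) * phi t (z - y) +
     (z + y) / (2 * t) * phi t (z + y)).
  have A : is_derive y (1 : R) (fun y => phi t (-1 * y + z))
      (- ((-1 * y + z) / (2 * t)) * phi t (-1 * y + z) * -1).
    by apply: is_derive_affine; exact: is_derive_phi.
  have B' : is_derive y (1 : R) (fun y => phi t (1 * y + z))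
      (- ((1 * y + z) / (2 * t)) * phi t (1 * y + z) * 1).
    by apply: is_derive_affine; exact: is_derive_phi.
  rewrite (_ : d = (fun y => phi t (-1 * y + z)) - (fun y => phi t (1 * y + z))).
    refine (is_derive_eq (is_deriveB A B') _).
    by rewrite mulN1r mul1r (addrC _ z) (addrC y); ring.
  by apply/funext => u; rewrite !fctE /d mulN1r mul1r !(addrC z).
have dF y : 0 < y -> is_derive y (1 : R) F (q y * w y + d y * v y).
  move=> y0; refine (is_derive_eq (is_derive_mul (dd y) (dw y y0)) _).
  by rewrite vE// /q /d; field; rewrite gt_eqF.
have cphi y : {for y, continuous (phi t : R -> R)}.
  exact: is_derive_continuous (is_derive_phi y t0).
have cd : continuous d by move=> y; exact: is_derive_continuous (dd y).
have cq : continuous q.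
  have c1 : continuous (fun y => phi t (z - y)).
    move=> y; apply: (@continuous_comp _ _ _ (fun y => z - y) (phi t)); last exact: cphi.
    by apply: cvgB; [exact: cvg_cst|exact: cvg_id].
  have c2 : continuous (fun y => phi t (z + y)).
    move=> y; apply: (@continuous_comp _ _ _ (fun y => z + y) (phi t)); last exact: cphi.
    by apply: cvgD; [exact: cvg_cst|exact: cvg_id].
  move=> y; apply: cvgD; apply: cvgM; [|exact: c1| |exact: c2]; apply: cvgM;
    try exact: cvg_cst; apply: cvgD; try exact: cvg_cst; apply: cvgD;
    try exact: cvg_cst; try apply: cvgN; exact: cvg_id.
apply/eqP; transitivity (0 - F 0); last first.
  by rewrite /F /d subr0 addr0 subrr mul0r subr0.
have F0 : F 0 = 0 by rewrite /F /d subr0 addr0 subrr mul0r.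
apply: Rintegral_itvoy_FTC => //.
- move=> y y0; apply: cvgD; apply: cvgM.
  + exact: cq.
  + exact: cw.
  + exact: cd.
  + exact: cv.
- have := integrable_lin 1 (measurable_itv `]0, +oo[) Iqw Idv.
  by apply: eq_integrable => // y _; rewrite /= mul1r.
- rewrite F0 /F; under eq_fun do rewrite mulrC.
  apply: (@cvg_bounded_mul0 _ _ _ _ _ C).
    by apply: filterS (nbhs_right_gt 0) => y; exact: wC.
  have d0 : d 0 = 0 by rewrite /d subr0 addr0 subrr.
  by rewrite -[X in _ --> X]d0; apply: cvg_at_right_filter; exact: cd.
- rewrite /F; under eq_fun do rewrite mulrC.
  apply: (@cvg_bounded_mul0 _ _ _ _ _ C).
    by near=> y; apply: wC; near: y; exact: nbhs_pinfty_gt.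
  rewrite -[X in _ --> X](subr0 0); apply: cvgB.
    rewrite (_ : (fun y => phi t (z - y)) = (fun y => phi t (y - z))); last first.
      by apply/funext => y; rewrite -phiN opprB.
    apply: (cvg_comp (fun y => y - z) (phi t)); last exact: cvg_phi_pinfty.
    exact: cvg_addrr.
  apply: (cvg_comp (fun y => z + y) (phi t)); last exact: cvg_phi_pinfty.
  exact: cvg_addrl.
Unshelve. all: by end_near. Qed.

End half_line_parts.

(** * The semigroup as a pair of paths of Schwartz functions *)

Section parity.
Context {R : realType}.
Implicit Types (f g H : R -> R) (k : nat) (a s t x y : R).

Lemma schwartz_sum f g (D : set R) : open D -> schwartz_on D f -> schwartz_on D g ->
  schwartz_on D (f + g).
Proof. by move=> oD sf sg; rewrite -(scale1r f); exact: schwartz_lin. Qed.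

Lemma scale_as_lin a f : a *: f = (a - 1) *: f + f.
Proof. by rewrite scalerBl scale1r subrK. Qed.

Lemma schwartz_scale a f (D : set R) : open D -> schwartz_on D f ->
  schwartz_on D (a *: f).
Proof. by move=> oD sf; rewrite scale_as_lin; exact: schwartz_lin. Qed.

Lemma deriv_rightZ a f k : schwartz_on punctured f ->
  deriv_right k (a *: f) = a * deriv_right k f.
Proof. by move=> sf; rewrite scale_as_lin deriv_right_lin//; ring. Qed.

Lemma deriv_leftZ a f k : schwartz_on punctured f ->
  deriv_left k (a *: f) = a * deriv_left k f.
Proof. by move=> sf; rewrite scale_as_lin deriv_left_lin//; ring. Qed.

Lemma deriv_rightD f g k : schwartz_on punctured f -> schwartz_on punctured g ->
  deriv_right k (f + g) = deriv_right k f + deriv_right k g.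
Proof. by move=> sf sg; rewrite -{1}(scale1r f) deriv_right_lin// mul1r. Qed.

Lemma deriv_leftD f g k : schwartz_on punctured f -> schwartz_on punctured g ->
  deriv_left k (f + g) = deriv_left k f + deriv_left k g.
Proof. by move=> sf sg; rewrite -{1}(scale1r f) deriv_left_lin// mul1r. Qed.

Lemma derive1n_linT a f g k x : schwartz_on setT f -> schwartz_on setT g ->
  derive1n k (a *: f + g) x = a * derive1n k f x + derive1n k g x.
Proof. by move=> sf sg; rewrite (derive1n_lin a openT sf.1 sg.1) ?inE. Qed.

Lemma derive1n_scale a f k x : schwartz_on setT f ->
  derive1n k (a *: f) x = a * derive1n k f x.
Proof.
by move=> sf; rewrite scale_as_lin derive1n_linT//; ring.
Qed.

Lemma derive1n_even0 g k : schwartz_on setT g -> mirror g = g ->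
  derive1n k.*2.+1 g 0 = 0.
Proof.
move=> sg gE; have := derive1n_mirror k.*2.+1 sg; rewrite gE.
move=> /(congr1 (fun f => f 0)); rewrite oppr0 -signr_odd /= odd_double expr1.
lra.
Qed.

Lemma derive1n_odd0 g k : schwartz_on setT g -> mirror g = -1 *: g ->
  derive1n k.*2 g 0 = 0.
Proof.
move=> sg gE; have := derive1n_mirror k.*2 sg; rewrite gE.
move=> /(congr1 (fun f => f 0)); rewrite derive1n_scale// oppr0.
rewrite -signr_odd odd_double expr0; lra.
Qed.

Lemma mirror_heat_even s g : schwartz_on setT g -> mirror g = g ->
  mirror (avg (phi 1) s g) = avg (phi 1) s g.
Proof.
move=> sg gE; have [B gB] := schwartz_bounded 0 sg.
rewrite -(avg_mirror s (gauss_moments ltr01) (phiN 1) _ gB) ?gE//.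
exact: (@schwartz_continuous _ g 0 sg).
Qed.

Lemma mirror_heat_odd s g : schwartz_on setT g -> mirror g = -1 *: g ->
  mirror (avg (phi 1) s g) = -1 *: avg (phi 1) s g.
Proof.
move=> sg gE; have [B gB] := schwartz_bounded 0 sg.
have cg := @schwartz_continuous _ g 0 sg.
rewrite -(avg_mirror s (gauss_moments ltr01) (phiN 1) cg gB) gE.
by apply/funext => x; rewrite (avgZ _ _ _ (gauss_moments ltr01) cg gB).
Qed.

Lemma mirrorK f : mirror (mirror f) = f.
Proof. by apply/funext => x; rewrite /mirror opprK. Qed.

Lemma mirror_splice_mirror f :
  mirror (patch0 (splice f (mirror f))) = patch0 (splice f (mirror f)).
Proof.
apply/funext => x; rewrite /mirror /patch0 oppr_eq0; case: eqP => // /eqP x0.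
rewrite /splice oppr_ge0 /mirror opprK.
by have [x1|x1|x1] := ltgtP 0 x => //; rewrite x1 eqxx in x0.
Qed.

End parity.

Section dynamics.
Context {R : realType}.
Local Notation mu := (@lebesgue_measure R).
Variable alpha : R.
Hypothesis alpha0 : 0 < alpha.
Implicit Types (f g H : R -> R) (k : nat) (a s t x y : R) (beta : \bar R).

(** Paths are parametrized by the square root of time because the heat flow at
time [t] averages translates by multiples of [sqrt t]. Membership in [Sbeta]
is part of the data: it ensures that the default value in the definition of
[semigroup] never occurs. *)
Definition paths_of beta H (p m : R -> R -> R) : Prop :=
  [/\ lip_path p, lip_path m, forall s, Sbeta alpha beta (splice (p s) (m s)) &
      forall s, 0 <= s ->
        semigroup_fun alpha beta s H = splice (p (Num.sqrt s)) (m (Num.sqrt s))].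

Local Notation heat := (avg (phi 1)).

Lemma paths_lt1 beta H : (beta < 1)%E -> Sbeta alpha beta H ->
  paths_of beta H (heat^~ H) (heat^~ H).
Proof.
rewrite /paths_of /Sbeta => b1; rewrite b1 => sH.
have L := lip_path_avg (gauss_moments ltr01) sH.
split; [exact: L|exact: L|move=> s|move=> s s0]; rewrite splice_same.
  exact: (L.1 s).
rewrite /semigroup_fun b1; case: eqP => [->|/eqP s1]; first by rewrite sqrtr0 avg0.
have [B gB] := schwartz_bounded 0 sH.
apply/funext => x; rewrite /semigroup_lt1 (@heat_avg _ _ _ _ B)//.
- by rewrite lt_neqAle eq_sym s1.
- exact: (@schwartz_continuous _ H 0 sH).
Qed.

(** Each half of [H] has a smooth even extension, and the reflected kernel on
the half-line acts on it as the heat kernel on the line. *)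
Lemma paths_gt1 beta H : ~~ (beta < 1)%E -> beta != 1%E -> Sbeta alpha beta H ->
  exists p m, paths_of beta H p m.
Proof.
rewrite /paths_of /Sbeta => /negbTE b1 /negbTE b2; rewrite b1 b2 => -[pH bH].
have sH := pH.1; have sM := schwartz_mirror_punctured sH.
pose Ep := patch0 (splice H (mirror H)).
pose Em := patch0 (splice (mirror H) (mirror (mirror H))).
have parity k c : (odd k -> c = 0) -> c = (-1) ^+ k * c :> R.
  move=> c0; rewrite -signr_odd; case: (odd k) c0 => [->//|_]; first by rewrite mulr0.
  by rewrite expr0 mul1r.
have odd0 k : odd k -> deriv_right k H = 0 /\ deriv_left k H = 0.
  by move=> ko; rewrite -[k]odd_double_half ko; exact: bH.
have sEp : schwartz_on setT Ep.
  apply: schwartz_patch0 => [|k]; first exact: schwartz_on_splice.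
  rewrite deriv_right_splice// deriv_left_splice// deriv_left_mirror//.
  by apply: parity => /odd0[].
have sEm : schwartz_on setT Em.
  apply: schwartz_patch0 => [|k].
    by apply: schwartz_on_splice => //; rewrite mirrorK.
  rewrite deriv_right_splice ?mirrorK// deriv_left_splice// deriv_right_mirror//.
  by apply/esym/parity => /odd0[].
have mEp := mirror_splice_mirror H; have mEm := mirror_splice_mirror (mirror H).
have Lp := lip_path_avg (gauss_moments ltr01) sEp.
have Lm := lip_path_avg (gauss_moments ltr01) sEm.
exists (heat^~ Ep), (heat^~ Em).
split; [exact: Lp|exact: Lm|move=> s|move=> s s0].
  split; first by apply: schwartz_splice; [exact: (Lp.1 s)|exact: (Lm.1 s)].
  move=> k; have [Sp Sm] := (Lp.1 s, Lm.1 s).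
  have Sp' := schwartz_setT_on Sp; have Sm' := schwartz_setT_on Sm.
  rewrite (deriv_right_splice _ Sp' Sm') (deriv_left_splice _ Sp' Sm').
  rewrite (deriv_right_smooth _ Sp) (deriv_left_smooth _ Sm); split.
    exact: (derive1n_even0 k Sp (mirror_heat_even s sEp mEp)).
  exact: (derive1n_even0 k Sm (mirror_heat_even s sEm mEm)).
have [Bp EpB] := schwartz_bounded 0 sEp; have [Bm EmB] := schwartz_bounded 0 sEm.
have cEp := @schwartz_continuous _ Ep 0 sEp.
have cEm := @schwartz_continuous _ Em 0 sEm.
rewrite /semigroup_fun b1 b2; case: eqP => [->|/eqP s1].
  rewrite sqrtr0 !avg0; apply: eq_schwartz_punctured => //.
    exact: schwartz_splice.
  move=> x; rewrite inE /punctured/= => x0.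
  rewrite {1}/splice /Ep /Em /patch0 (negbTE x0) /splice.
  by case: (leP 0 x) => // _; rewrite /mirror opprK.
have sp : 0 < s by rewrite lt_neqAle eq_sym s1.
have pos_pt (f g : R -> R) : {in `]0, +oo[, f =1 g} ->
    \int[mu]_(y in `]0, +oo[) f y = \int[mu]_(y in `]0, +oo[) g y.
  by move=> fg; apply: eq_Rintegral => y; rewrite inE => /fg.
apply/funext => x; rewrite /semigroup_gt1 /splice /sign.
case: ifP => x0.
- rewrite (heat_even_fold x sp cEp EpB); last first.
    by move=> y; exact: (congr1 (fun f => f y) mEp).
  rewrite -[RHS]Rintegral_itv_obnd_cbnd; last exact: integrable_reflected_heat EpB.
  rewrite -Rintegral_itv_obnd_cbnd.
    apply: pos_pt => y; rewrite in_itv/= andbT => y0.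
    by rewrite mulr1 /Ep /patch0 gt_eqF// /splice ltW.
  have := integrable_reflected_heat x sp cEp EpB; apply: eq_integrable => // y.
  rewrite inE/= in_itv/= andbT => y0.
  by rewrite mulr1 /Ep /patch0 gt_eqF// /splice ltW.
- rewrite (heat_even_fold x sp cEm EmB); last first.
    by move=> y; exact: (congr1 (fun f => f y) mEm).
  rewrite -[RHS]Rintegral_itv_obnd_cbnd; last exact: integrable_reflected_heat EmB.
  rewrite -Rintegral_itv_obnd_cbnd.
    apply: pos_pt => y; rewrite in_itv/= andbT => y0.
    by rewrite mulrN1 /Em /patch0 gt_eqF// /splice ltW.
  have := integrable_reflected_heat x sp cEm EmB; apply: eq_integrable => // y.
  rewrite inE/= in_itv/= andbT => y0.
  by rewrite mulrN1 /Em /patch0 gt_eqF// /splice ltW.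
Qed.

(** The average [U] satisfies [U' = a U - V], and this relation can be
differentiated any number of times. *)
Lemma derive1n_exp_average a V k x : 0 < a -> schwartz_on setT V ->
  derive1n k.+1 (avg (exp_kernel a) (-1) V) x =
  a * derive1n k (avg (exp_kernel a) (-1) V) x - derive1n k V x.
Proof.
move=> a0 sV; have mX := exp_kernel_moments a0.
rewrite !(schwartz_avg mX (-1) sV).2.
have [B0 V0] := schwartz_bounded k sV; have [B1 V1] := schwartz_bounded k.+1 sV.
have c0 := @schwartz_continuous _ V k sV.
have c1 := @schwartz_continuous _ V k.+1 sV.
pose g := derive1n k.+1 V - a *: derive1n k V.
have c0' : continuous (a *: derive1n k V).
  by move=> y; apply: cvgMr; exact: c0.
have V0' y : `|(a *: derive1n k V) y| <= a * B0.
  by rewrite /GRing.scale/= normrM gtr0_norm// ler_wpM2l// ltW.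
have cg : continuous g by move=> y; apply: cvgB; [exact: c1|exact: c0'].
have gB y : `|g y| <= B1 + a * B0.
  by rewrite (le_trans (ler_normB _ _))// lerD.
have dV y : x <= y -> is_derive y (1 : R) (derive1n k V) (derive1n k.+1 V y).
  by move=> _; exact: (smooth_is_derive k sV.1).
have := avg_exp_kernel_ftc a0 dV (fun y _ => V0 y) cg gB (fun y _ => erefl).
rewrite /g (avgB (-1) x mX c1 c0' V1 V0') (avgZ (-1) x _ mX c0 V0).
lra.
Qed.

(** At 0 the even function [E] contributes nothing to the derivatives of odd
order and no jump to those of even order. For [U], the last hypothesis
expresses each derivative of odd order by the preceding one, since the
derivatives of even order of the odd function [V] vanish at 0. *)
Lemma Sbeta_robin E V U : schwartz_on setT E -> schwartz_on setT V ->
  schwartz_on setT U -> mirror E = E -> mirror V = -1 *: V ->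
  (forall k x, derive1n k.+1 U x = 2 * alpha * derive1n k U x - derive1n k V x) ->
  Sbeta alpha 1%E (splice (-1 *: U + E) (1 *: mirror U + E)).
Proof.
move=> sE sV sU ME MV DU; rewrite /Sbeta ltxx eqxx; have sMU := schwartz_mirror sU.
have Sp := schwartz_lin (-1) openT sU sE; have Sm := schwartz_lin 1 openT sMU sE.
split; first exact: schwartz_splice.
have Dp n : derive1n n (-1 *: U + E) 0 = - derive1n n U 0 + derive1n n E 0.
  by rewrite derive1n_linT// mulN1r.
have Dm n : derive1n n (1 *: mirror U + E) 0 =
    (-1) ^+ n * derive1n n U 0 + derive1n n E 0.
  by rewrite derive1n_linT// mul1r derive1n_mirror// oppr0.
have Sp' := schwartz_setT_on Sp; have Sm' := schwartz_setT_on Sm.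
move=> k; rewrite !(deriv_right_splice _ Sp' Sm') !(deriv_left_splice _ Sp' Sm').
rewrite !(deriv_right_smooth _ Sp) !(deriv_left_smooth _ Sm) !Dp !Dm.
rewrite !(derive1n_even0 k sE ME) DU (derive1n_odd0 k sV MV).
rewrite -!(signr_odd _ k.*2) -!(signr_odd _ k.*2.+1) /= odd_double /= expr0 expr1.
by split; ring.
Qed.

(** The even part is treated as for [beta > 1]. The odd part [w] is replaced
by [w' - 2 alpha w], whose odd extension [v0] is smooth by the boundary
conditions; [w] is recovered from [v0] by the exponential average. *)
Lemma paths_eq1 H : Sbeta alpha 1%E H -> exists p m, paths_of 1%E H p m.
Proof.
move=> SH; have := SH; rewrite /Sbeta ltxx eqxx => -[pH bH] {SH}.
have sH := pH.1; have sM := schwartz_mirror_punctured sH.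
have op := @open_punctured R.
pose h2 : R := 2^-1.
have E2 : even_part H = h2 *: (H + mirror H).
  by apply/funext => x; rewrite /even_part mulrC.
have W2 : odd_part H = h2 *: (-1 *: mirror H + H).
  apply/funext => x; rewrite /odd_part !fctE /GRing.scale/= /GRing.scale/=.
  by rewrite mulN1r mulrC addrC.
pose w := odd_part H.
have sE : schwartz_on punctured (even_part H).
  by rewrite E2; apply: schwartz_scale => //; exact: schwartz_sum.
have sW1 := schwartz_lin (-1) op sM sH.
have sw : schwartz_on punctured w by rewrite /w W2; exact: schwartz_scale.
(* even part: the odd derivatives of [H] agree on both sides of 0 and cancel,
   while those of even order agree by symmetry *)
pose E := patch0 (even_part H).
have sET : schwartz_on setT E.
  apply: schwartz_patch0 => // k.
  have SS := schwartz_sum op sH sM.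
  rewrite E2 deriv_rightZ// deriv_leftZ//; congr (_ * _).
  rewrite deriv_rightD// deriv_leftD//.
  rewrite deriv_right_mirror// deriv_left_mirror//.
  rewrite -signr_odd -[k]odd_double_half; have [b1 b2] := bH k./2.
  case: (odd k); rewrite ?odd_double ?add1n ?add0n /= ?expr1 ?expr0 ?mul1r.
    by rewrite b1; ring.
  by rewrite addrC.
have ME : mirror E = E.
  apply/funext => x; rewrite /mirror /E /patch0 oppr_eq0; case: eqP => // _.
  by rewrite /even_part opprK addrC.
pose w' := derive1n 1 w.
have w'E k : derive1n k w' = derive1n k.+1 w by rewrite -(addn1 k) /derive1n iterD.
have sw' : schwartz_on punctured w'.
  split=> [k u Pu|k l]; first by rewrite w'E; exact: sw.1.
  have [M _ wM] := schwartz_on_bound k.+1 l sw.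
  by apply/seminorm_onP; exists M => u Pu; rewrite w'E; exact: wM.
have Rw' k : deriv_right k w' = deriv_right k.+1 w by rewrite /deriv_right w'E.
pose h := - (2 * alpha) *: w + w'.
have sh : schwartz_on punctured h by exact: schwartz_lin.
have smh := schwartz_mirror_punctured sh.
have sNmh : schwartz_on punctured (-1 *: mirror h) by exact: schwartz_scale.
have Rw k : deriv_right k w = h2 * (deriv_right k H - (-1) ^+ k * deriv_left k H).
  by rewrite /w W2 deriv_rightZ// deriv_right_lin// deriv_right_mirror//; ring.
have Rh k : deriv_right k.*2 h = 0.
  rewrite deriv_right_lin// Rw' !Rw; have [b1 b2] := bH k.
  rewrite -!(signr_odd _ k.*2) -!(signr_odd _ k.*2.+1) /= odd_double /= expr0 expr1.
  by rewrite b1 b2 /h2; field.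
(* an odd extension is smooth at 0 when the derivatives of even order vanish
   there, which is what [Rh] states *)
pose v0 := patch0 (splice h (-1 *: mirror h)).
have sv0 : schwartz_on setT v0.
  apply: schwartz_patch0 => [|k]; first exact: schwartz_on_splice.
  rewrite deriv_right_splice// deriv_left_splice// deriv_leftZ// deriv_left_mirror//.
  rewrite -signr_odd -[k]odd_double_half.
  case: (odd k); rewrite ?odd_double ?add1n ?add0n /= ?odd_double /= ?expr1 ?expr0.
    by ring.
  by rewrite Rh; ring.
have v00 : v0 0 = 0.
  by rewrite /v0 /patch0 eqxx deriv_right_splice//; exact: (Rh 0%N).
have v0pos x : 0 < x -> v0 x = w' x - 2 * alpha * w x.
  move=> x0; rewrite /v0 /patch0 gt_eqF// /splice ltW//.
  by rewrite /h !fctE /GRing.scale/=; ring.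
have Mv0 x : v0 (- x) = - v0 x.
  have [->|x0] := eqVneq x 0; first by rewrite oppr0 v00 oppr0.
  rewrite /v0 /patch0 oppr_eq0 (negbTE x0) /splice oppr_ge0.
  have [x1|x1|x1] := ltgtP 0 x; last by rewrite x1 eqxx in x0.
  - by rewrite !fctE /GRing.scale/= /mirror opprK mulN1r.
  - by rewrite !fctE /GRing.scale/= /mirror mulN1r opprK.
have Mv0' : mirror v0 = -1 *: v0.
  by apply/funext => x; rewrite /mirror Mv0 /GRing.scale/= /GRing.scale/= mulN1r.
have [Bv v0B] := schwartz_bounded 0 sv0; have [BE EB] := schwartz_bounded 0 sET.
have cv0 := @schwartz_continuous _ v0 0 sv0.
have cE := @schwartz_continuous _ E 0 sET.
have a2 : 0 < 2 * alpha by rewrite mulr_gt0.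
have mX := exp_kernel_moments a2.
pose J g := avg (exp_kernel (2 * alpha)) (-1) g.
pose U s := J (heat s v0).
have LE := lip_path_avg (gauss_moments ltr01) sET.
have LV := lip_path_avg (gauss_moments ltr01) sv0.
have LU : lip_path U by exact: (lip_path_postavg (-1) mX LV).
have LMU := lip_path_mirror LU.
pose p s := -1 *: U s + heat s E.
pose m s := 1 *: mirror (U s) + heat s E.
have Lp : lip_path p by exact: lip_path_lin.
have Lm : lip_path m by exact: lip_path_lin.
have dw y : 0 < y -> is_derive y (1 : R) w (w' y).
  by move=> y0; apply: (smooth_is_derive 0 sw.1); rewrite /punctured/= gt_eqF.
have [Bw _ wB'] := schwartz_on_bound 0 0 sw.
have wB y : 0 < y -> `|w y| <= Bw.
  move=> y0; apply: le_trans (wB' y _); last by rewrite /punctured/= gt_eqF.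
  by rewrite [leRHS]normrM ler_peMl// ger0_norm ?weight_ge0 ?weight_ge1.
have wN x : w (- x) = - w x by rewrite /w /odd_part opprK -mulNr opprB.
have EwH x : x != 0 -> E x + w x = H x.
  by move=> x0; rewrite /E /patch0 (negbTE x0) /w /even_part /odd_part; field.
exists p, m; split; [exact: Lp|exact: Lm|move=> s|move=> s s0].
- apply: (@Sbeta_robin (heat s E) (heat s v0) (U s)).
  + exact: (LE.1 s).
  + exact: (LV.1 s).
  + exact: (LU.1 s).
  + exact: (mirror_heat_even s sET ME).
  + exact: (mirror_heat_odd s sv0 Mv0').
  + by move=> n x; exact: (derive1n_exp_average n x a2 (LV.1 s)).
- rewrite /semigroup_fun ltxx eqxx; case: eqP => [->|/eqP s1].
    rewrite sqrtr0; apply: eq_schwartz_punctured => //.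
      by apply: schwartz_splice; [exact: (Lp.1 0)|exact: (Lm.1 0)].
    have U0 x : 0 < x -> U 0 x = - w x.
      move=> x0; rewrite /U /J avg0.
      apply: (avg_exp_kernel_ftc a2 (f' := w') _ _ cv0 v0B).
      + by move=> y xy; apply: dw; exact: lt_le_trans xy.
      + by move=> y xy; apply: wB; exact: lt_le_trans xy.
      + by move=> y xy; apply: v0pos; exact: lt_trans xy.
    move=> x; rewrite inE /punctured/= => x0; rewrite -(EwH x x0).
    rewrite /splice; have [x1|x1|x1] := ltgtP 0 x; last by rewrite -x1 eqxx in x0.
    - by rewrite /p !fctE /GRing.scale/= U0// avg0 mulN1r opprK addrC.
    - by rewrite /m !fctE /GRing.scale/= /mirror U0 ?oppr_gt0// avg0 wN opprK mul1r addrC.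
  have sp : 0 < s by rewrite lt_neqAle eq_sym s1.
  apply/funext => x; rewrite /semigroup_eq1.
  rewrite (_ : \int[mu]_y _ = heat (Num.sqrt s) E x); last first.
    rewrite -(heat_avg x sp cE EB); apply: Rintegral_eq_punctured.
      by have /integrableP[/measurable_EFinP] := integrable_heat x sp cE EB.
    by move=> y; rewrite inE /punctured/= => y0; rewrite /E /patch0 (negbTE y0).
  have SV := LV.1 (Num.sqrt s); have [BV VB] := schwartz_bounded 0 SV.
  have cV := @schwartz_continuous _ (heat (Num.sqrt s) v0) 0 SV.
  pose NV := -1 *: heat (Num.sqrt s) v0.
  have cNV : continuous NV by move=> y; apply: cvgMr; exact: cV.
  have NVB y : `|NV y| <= BV.
    by rewrite /NV /GRing.scale/= /GRing.scale/= mulN1r normrN; exact: VB.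
  (* the inner integral of the explicit formula is the heat flow of [- v0] *)
  rewrite (_ : \int[mu]_(z in `[`|x|, +oo[) _ =
      \int[mu]_(z in `[`|x|, +oo[) (expR (- (2 * alpha * z)) * NV z)); last first.
    apply: eq_Rintegral => z _; congr (_ * _).
    rewrite (heat_robin z sp dw wB cv0 v0B Mv0 v0pos).
    by rewrite /NV /GRing.scale/= /GRing.scale/= mulN1r.
  rewrite -mulrA (half_line_exp_integral `|x| a2 cNV NVB) (avgZ _ _ _ mX cV VB).
  rewrite /splice /sign; case: ifP => x0.
  - by rewrite ger0_norm// mul1r /p !fctE /GRing.scale/= addrC.
  - have xn : x < 0 by rewrite ltNge x0.
    by rewrite ltr0_norm// /m !fctE /GRing.scale/= /mirror mulrA mulrNN !mul1r addrC.
Qed.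

Lemma semigroup_paths beta H : Sbeta alpha beta H ->
  exists p m, paths_of beta H p m.
Proof.
have [b1 sH|b1] := boolP (beta < 1)%E.
  by exists (heat^~ H), (heat^~ H); exact: paths_lt1.
have [->|b2] := eqVneq beta 1%E; first exact: paths_eq1.
exact: paths_gt1.
Qed.

End dynamics.

(** * Joint continuity *)

Section dual_topology.
Context {R : realType} {E : tvsType R}.

(** Uniform convergence on bounded sets, read on a single one of them. *)
Lemma strong_dual_within (D : set R) (Y : R -> strong_dual E) (t0 : R) (B : set E) (e : R) :
  {within D, continuous Y} -> D t0 -> @tvs_bounded _ _ B -> 0 < e ->
  \forall t \near t0, D t -> forall F, B F -> `|Y t0 F - Y t F| < e.
Proof.
move=> /subspace_continuousP/(_ t0) cY Dt0 bB e0; have {}cY := cY Dt0.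
pose V : set {family @tvs_bounded _ E, E -> R} :=
  [set g | forall F, B F -> ball (Y t0 F) e (g F)].
have nV : nbhs (dual_fun (Y t0) : {family @tvs_bounded _ E, E -> R}) V.
  have H : {family @tvs_bounded _ E,
      nbhs (dual_fun (Y t0) : {family @tvs_bounded _ E, E -> R}) --> dual_fun (Y t0)}.
    exact: cvg_id.
  move/fam_cvgP : H => /(_ B bB) H; apply: H.
  apply/uniform_nbhs; exists [set xy | ball xy.1 e xy.2]; split.
    exact: (entourage_ball _ (PosNum e0)).
  by move=> g /= Hg F BF; exact: Hg.
pose ev := @dual_fun _ E : strong_dual E -> {family @tvs_bounded _ E, E -> R}.
have nW : nbhs (Y t0) (ev @^-1` V).
  have := @initial_continuous _ _ ev (Y t0).
  by apply.
have near_Y : \forall t \near t0, D t -> V (@dual_fun _ E (Y t)) := cY _ nW.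
by apply: filterS near_Y => t H Dt F BF; exact: H.
Qed.

End dual_topology.

Section continuity.
Context {R : realType} {alpha : R} {beta : \bar R}.
Local Notation S := (testfun alpha beta).
Implicit Types (F G H : S) (k l N : nat).

(** A neighbourhood of the space of test functions involves finitely many
seminorms; this merges their constants. *)
Lemma finite_uniform_bound (P : nat -> nat -> R -> Prop) N :
  (forall k l C D, C <= D -> P k l C -> P k l D) ->
  (forall k l, exists C, P k l C) ->
  exists C, forall k l, (k <= N)%N -> (l <= N)%N -> P k l C.
Proof.
move=> mP eP; pose C k l := sval (cid (eP k l)).
have PC k l : P k l (C k l) by rewrite /C; case: cid.
exists (\big[Num.max/0]_(i < N.+1) \big[Num.max/0]_(j < N.+1) C i j) => k l kN lN.
apply: mP (PC k l).
apply: (@le_trans _ _ (\big[Num.max/0]_(j < N.+1) C k j)).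
  exact: (le_bigmax _ (fun j : 'I_N.+1 => C k j) (Ordinal (lN : (l < N.+1)%N))).
exact: (le_bigmax _ (fun i : 'I_N.+1 => \big[Num.max/0]_(j < N.+1) C i j)
   (Ordinal (kN : (k < N.+1)%N))).
Qed.

(** A set on which every seminorm is bounded is absorbed by every
neighbourhood of 0. *)
Lemma tvs_bounded_tnorm (B : set S) :
  (forall k l, exists M, forall G, B G -> tnorm k l G <= M) -> @tvs_bounded _ _ B.
Proof.
move=> bB U /nbhs_testfunP[N [e [e0 NU]]].
have [M HM] : exists M, forall k l, (k <= N)%N -> (l <= N)%N ->
    forall G, B G -> tnorm k l G <= M.
  apply: (finite_uniform_bound N) bB => k l C D CD HC G /HC.
  by move/le_trans; apply.
have M1 : 0 < `|M| + 1 by rewrite ltr_wpDl.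
exists ((`|M| + 1) / e); first by rewrite divr_gt0.
move=> a ra G BG.
have a0 : 0 < `|a| by apply: lt_le_trans ra; rewrite divr_gt0.
exists (a^-1 *: G); last by rewrite scalerA mulfV ?scale1r// -normr_gt0.
apply: NU => k l kN lN; rewrite sub0r tnormN.
apply: (le_lt_trans (tnormZ _ _ _ _)).
rewrite normfV -ltr_pdivlMl ?invr_gt0// invrK.
apply: (le_lt_trans (HM k l kN lN G BG)).
rewrite ler_pdivrMr// in ra; apply: lt_le_trans ra.
by rewrite (le_lt_trans (ler_norm _))// ltrDl.
Qed.

Variable T : R -> S.
Variables p m : R -> R -> R.
Hypotheses (Lp : lip_path p) (Lm : lip_path m).
Hypothesis TE : forall s, 0 <= s -> val (T s) = splice (p (Num.sqrt s)) (m (Num.sqrt s)).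

Lemma tnorm_path k l (M : R) : exists2 C, 0 <= C & forall s t, 0 <= s <= M -> 0 <= t <= M ->
  tnorm k l (T s - T t) <= C * `|Num.sqrt s - Num.sqrt t|.
Proof.
have [sp lp] := Lp; have [sm lm] := Lm.
have [C C0 pC] := lp k l (Num.sqrt M); have [D D0 mD] := lm k l (Num.sqrt M).
exists (Num.max C D) => [|s t /andP[s0 sM] /andP[t0 tM]]; first by rewrite le_max C0.
have sS : `|Num.sqrt s| <= Num.sqrt M by rewrite ger0_norm ?sqrtr_ge0// ler_wsqrtr.
have tS : `|Num.sqrt t| <= Num.sqrt M by rewrite ger0_norm ?sqrtr_ge0// ler_wsqrtr.
apply: tnorm_le => u u0.
have [Ts _] := testfun_schwartz (T s); have [Tt _] := testfun_schwartz (T t).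
have -> : T s - T t = -1 *: T t + T s by rewrite scaleN1r addrC.
rewrite (_ : val _ = -1 *: val (T t) + val (T s))//.
rewrite (derive1n_lin (-1) open_punctured Tt Ts) ?inE// !TE//.
have up : u \in punctured by rewrite inE.
have Ep s' : splice (derive1n k (p s')) (derive1n k (m s')) u =
    derive1n k (splice (p s') (m s')) u.
  apply/esym.
  exact: (derive1n_splice k (schwartz_setT_on (sp s')) (schwartz_setT_on (sm s')) up).
rewrite !fctE /GRing.scale/= /GRing.scale/= -!Ep mulN1r addrC /splice.
case: ifP => _.
  by apply: (le_trans (pC _ _ sS tS u)); rewrite ler_wpM2r// le_max lexx.
by apply: (le_trans (mD _ _ sS tS u)); rewrite ler_wpM2r// le_max lexx orbT.
Qed.

Lemma path_bounded M : @tvs_bounded _ S (T @` [set s | 0 <= s <= M]).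
Proof.
apply: tvs_bounded_tnorm => k l.
have [C C0 TC] := tnorm_path k l M.
exists (C * Num.sqrt M + tnorm k l (T 0)) => _ [s /= sM <-].
have /andP[s0 sM'] := sM.
have T0 := TC s 0 sM; rewrite lexx (le_trans s0 sM') in T0.
rewrite -[T s](subrK (T 0)) (le_trans (tnormD _ _ _ _))// lerD2r.
apply: (le_trans (T0 isT)); rewrite sqrtr0 subr0 ger0_norm ?sqrtr_ge0//.
by rewrite ler_wpM2l// ler_wsqrtr.
Qed.

(** [tnorm_path] bounds the increments by those of the square root, which is
continuous at 0 too. *)
Lemma path_continuous s0 : 0 <= s0 ->
  forall A, nbhs (T s0) A -> \forall s \near s0, 0 <= s -> A (T s).
Proof.
move=> s00 A /nbhs_testfunP[N [e [e0 NA]]].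
have [C HC] : exists C, forall k l, (k <= N)%N -> (l <= N)%N ->
    forall s, 0 <= s <= s0 + 1 ->
    tnorm k l (T s0 - T s) <= C * `|Num.sqrt s0 - Num.sqrt s|.
  apply: finite_uniform_bound => [k l C D CD HC s /HC/le_trans|k l].
    by apply; rewrite ler_wpM2r.
  have [C _ TC] := tnorm_path k l (s0 + 1); exists C => s ss.
  by apply: TC => //; rewrite s00 lerDl ler01.
have C1 : 0 < `|C| + 1 by rewrite ltr_wpDl.
have csqrt : Num.sqrt s @[s --> s0] --> Num.sqrt s0 by exact: sqrt_continuous.
move/cvgrPdist_lt : csqrt => /(_ (e / (`|C| + 1)))/(_ (divr_gt0 e0 C1)) near_sqrt.
near=> s => s_ge0; apply: NA => k l kN lN.
apply: (le_lt_trans (HC k l kN lN s _)).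
  rewrite s_ge0/=; apply: ltW; near: s.
  by apply: lt_nbhsl; rewrite ltrDl.
apply: (@le_lt_trans _ _ ((`|C| + 1) * `|Num.sqrt s0 - Num.sqrt s|)).
  by rewrite ler_wpM2r// (le_trans (ler_norm _))// lerDl.
rewrite -ltr_pdivlMl// mulrC; near: s; exact: near_sqrt.
Unshelve. all: by end_near. Qed.

Lemma joint_continuity (Y : R -> strong_dual S) :
  (forall M : R, 0 < M -> {within `[0, M], continuous Y}) ->
  {within [set st : R * R | 0 <= st.1 /\ 0 <= st.2],
     continuous (fun st => Y st.2 (T st.1))}.
Proof.
move=> cY; apply/subspace_continuousP => -[s0 t0] /= [s00 t00].
apply/cvgrPdist_lt => e e0; rewrite near_withinE /=.
have e2 : 0 < e / 2 by rewrite divr_gt0.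
have M0 : 0 < t0 + 1 by rewrite ltr_wpDl.
have D0 : `[0, t0 + 1]%classic t0 by rewrite /= in_itv/= t00 lerDl ler01.
have Ht := strong_dual_within (cY _ M0) D0 (path_bounded (s0 + 1)) e2.
have Ht2 : \forall t \near t0, t < t0 + 1 by apply: lt_nbhsl; rewrite ltrDl.
have Hs2 : \forall s \near s0, s < s0 + 1 by apply: lt_nbhsl; rewrite ltrDl.
have Hs : \forall s \near s0, 0 <= s -> `|Y t0 (T s0) - Y t0 (T s)| < e / 2.
  apply: (path_continuous s00 (A := [set G | `|Y t0 (T s0) - Y t0 G| < e / 2])).
  have /cvgrPdist_lt/(_ _ e2) := @dual_continuous _ _ (Y t0) (T s0).
  by [].
exists ([set s | (0 <= s -> `|Y t0 (T s0) - Y t0 (T s)| < e / 2) /\ s < s0 + 1],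
        [set t | (`[0, t0 + 1]%classic t -> forall F, (T @` [set s | 0 <= s <= s0 + 1]) F ->
           `|Y t0 F - Y t F| < e / 2) /\ t < t0 + 1]).
  by split=> /=; apply: filterI.
move=> [s t] /= [[Hs1 s1] [Ht1 t1]] [s_ge0 t_ge0].
rewrite -(subrKA (Y t0 (T s))) (le_lt_trans (ler_normD _ _))// (splitr e) ltrD//.
  exact: Hs1.
apply: Ht1; first by rewrite /= in_itv/= t_ge0 ltW.
by exists s => //=; rewrite s_ge0 ltW.
Qed.

End continuity.

Theorem proposition4p3 (R : realType) (alpha rho : R) (beta : \bar R)
  (d : measure_display) (Omega : measurableType d) (P : probability Omega R)
  (Y : R -> Omega -> strong_dual (testfun alpha beta)) :
  0 < alpha -> 0 < rho < 1 -> (0 <= beta)%E ->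
  OU_solution rho P Y ->
  forall H : testfun alpha beta,
    (forall s : R, 0 <= s -> val (semigroup s H) = semigroup_fun alpha beta s (val H)) /\
    forall w : Omega,
      {within [set st : R * R | 0 <= st.1 /\ 0 <= st.2],
         continuous (fun st => Y st.2 w (semigroup st.1 H))}.
Proof.
move=> alpha0 _ _ [_ cY _ _] H.
have [p [m [Lp Lm Sm TE]]] := semigroup_paths alpha0 (testfunP H).
have sgE s : 0 <= s -> val (semigroup s H) = semigroup_fun alpha beta s (val H).
  move=> s0; rewrite /semigroup insubdK//; apply: mem_set.
  by rewrite TE.
split=> // w; have TE' s (s0 : 0 <= s) := etrans (sgE s s0) (TE s s0).
exact: (joint_continuity Lp Lm TE' (cY w)).
Qed.
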